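(* Let $(E,J,R,Q,B,u,x_0,T)$ be coupled PH-DAE data (as defined in the context), let $\lambda>0$, $\alpha\in[0,1]$, $\mu\ge 0$, and let $\omega\in\mathbb{R}$ with $0\le\mu\le\omega$. Let $M$ and $N$ be the operators on $L^2_\omega([0,T],\mathbb{R}^n)$ given by $$Mx=\tfrac{\mathrm d}{\mathrm dt}(Ex)-(J_d-\alpha R+\mu EQ^{-1})Qx-Bu,\qquad x\in D(M),$$ $$D(M)=\{x\in L^2_\omega([0,T],\mathbb{R}^n)\mid Ex\in H^1([0,T],\mathbb{R}^n),\ Ex(0)=Ex_0\},$$ $$Nx=\big((1-\alpha)R+\mu EQ^{-1}-J_o\big)Qx,\qquad x\in L^2_\omega([0,T],\mathbb{R}^n).$$ Let $x^0\in D(M)$ and let the sequence $(x^k)_k$ be defined recursively by $$x^{k+1}:=Q^{-1}(I+\lambda MQ^{-1})^{-1}(I-\lambda NQ^{-1})(I+\lambda NQ^{-1})^{-1}(I-\lambda MQ^{-1})Qx^k .$$ Let $x$ be the unique (weak) solution of $\tfrac{\mathrm d}{\mathrm dt}Ex(t)=(J-R)Qx(t)+Bu(t)$, $t\in[0,T]$, $Ex(0)=Ex_0$. Then: (a) $(Ex^k)_k$ converges to $Ex$ in $L^2([0,T],\mathbb{R}^n)$. (b) $(Ex^k)_k$ converges pointwise to $Ex$ on $(0,T]$. (c) If $\alpha>0$, then $(RQx^k)_k$ converges to $RQx$ in $L^2([0,T],\mathbb{R}^n)$. (d) For the sequence $z^k:=(I+\lambda MQ^{-1})Qx^k$ and the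 function $z:=(I+\lambda MQ^{-1})Qx$, the real sequence $(\|z^k-z\|_{2,\omega})_k$ is monotonically decreasing (in the non-strict sense), and for all $k\in\mathbb{N}$ $$\|x^k-x\|_{2,\omega}\le\|Q^{-1}\|\,\|z^k-z\|_{2,\omega}.$$
   Context: Coupled PH-DAE data. $T>0$, and for some $s,n_1,\dots,n_s\in\mathbb{N}$ with $n=n_1+\dots+n_s$ and some $m$, the real matrices $E,J,R,Q\in\mathbb{R}^{n\times n}$, $B\in\mathbb{R}^{n\times m}$, the input $u$ and $x_0$ satisfy: (A1) $E=\mathrm{diag}(E_1,\dots,E_s)$, $R=\mathrm{diag}(R_1,\dots,R_s)$, $Q=\mathrm{diag}(Q_1,\dots,Q_s)$ are block diagonal; $J$ has diagonal blocks $J_1,\dots,J_s$, its $(i,j)$ block for $i<j$ is $J_{ij}\in\mathbb{R}^{n_i\times n_j}$ and its $(j,i)$ block for $i<j$ is $-J_{ij}^\top$; $B$ is the vertical stack of $B_1,\dots,B_s$ with $B_i\in\mathbb{R}^{n_i\times m}$. Here $E_i,Q_i,J_i,R_i\in\mathbb{R}^{n_i\times n_i}$, $R_i=R_i^\top\ge0$, $J_i^\top=-J_i$, $E_i^\top Q_i=Q_i^\top E_i\ge 0$ (positive semidefinite), and $Q_i$ is invertible. (A2) $\mathrm{rk}\,[E\ \ R\ \ J]=n$. (A3) $u\in L^2([0,T],\mathbb{R}^m)$, $x_0\in\mathbb{R}^n$, and for matrices $Z\in\mathbb{R}^{n\times r}$, $Z_1\in\mathbb{R}^{r\times r_1}$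 of full column rank with $\mathrm{im}\,Z=\ker E$ and $\mathrm{im}\,Z_1=\ker (RQZ)\cap\ker (Z^\top Q^\top JQZ)$, one has $Z_1^\top Z^\top Q^\top Bu\in H^1([0,T],\mathbb{R}^{r_1})$ and $Z_1^\top Z^\top Q^\top(JQx_0+Bu(0))=0$ (with $Z_1^\top Z^\top Q^\top Bu(0)$ the value at $0$ of the $H^1$ function). $J_d:=\mathrm{diag}(J_1,\dots,J_s)$ is the block-diagonal part of $J$ and $J_o:=J-J_d$ its off-block-diagonal part; both are skew-symmetric. Weak solution: $x\in L^2([0,T],\mathbb{R}^n)$ with $Ex\in H^1([0,T],\mathbb{R}^n)$, $Ex(0)=Ex_0$, and the differential-algebraic equation satisfied for almost every $t\in[0,T]$. (It exists and is unique for coupled PH-DAE data.) Here $\tfrac{\mathrm d}{\mathrm dt}Ex$ is the weak derivative of $Ex$, and point values of $Ex$ are those of its continuous representative. For $\omega\ge0$, $L^2_\omega([0,T],\mathbb{R}^n)$ is the space of $f:[0,T]\to\mathbb{R}^n$ with $t\mapsto e^{-\omega t}f(t)\in L^2([0,T],\mathbb{R}^n)$, with norm $\|f\|_{2,\omega}^2=\int_0^Te^{-2\omega t}\|f(t)\|^2\,\mathrm dt$ and the associated inner product; as a set it equals $L^2([0,T],\mathbb{R}^n)$, with equivalent norms. $\|\cdot\|$ is the Euclidean norm and, for matrices, the induced operator norm. $Q$ and $Q^{-1}$ also denote pointwise multiplication operators. $MQ^{-1}$ has domain $Q\,D(M)$; $M$ is affine-linear. The operators $I+\lambda MQ^{-1}:Q\,D(M)\to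 L^2_\omega([0,T],\mathbb{R}^n)$ and $I+\lambda NQ^{-1}$ on $L^2_\omega([0,T],\mathbb{R}^n)$ are bijective, so that the iteration is well defined with $x^k\in D(M)$ for all $k$. *)

(* Defs.v *)
From HB Require Import structures.
From mathcomp Require Import all_boot all_order all_algebra.
From mathcomp Require Import all_classical all_reals all_analysis.

Set Implicit Arguments.
Unset Strict Implicit.
Unset Printing Implicit Defensive.

Import Order.TTheory GRing.Theory Num.Theory.
Import numFieldNormedType.Exports.

Local Open Scope classical_set_scope.
Local Open Scope ring_scope.

Section Matrices.
Context {K : realType}.

(* "A = A^T >= 0"; over the reals symmetry has to be required separately. *)
Definition psdmx n (A : 'M[K]_n) : Prop :=
  A^T = A /\ forall v : 'cV[K]_n, 0 <= (v^T *m A *m v) ord0 ord0.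

(* Euclidean norm; the library's [`|v|] on matrices is the maximum norm. *)
Definition enorm n (v : 'cV[K]_n) : K := Num.sqrt (\sum_i v i ord0 ^+ 2).

Definition opnorm p n (A : 'M[K]_(p, n)) : K :=
  sup [set enorm (A *m v) | v in [set v : 'cV[K]_n | enorm v <= 1]].

(* Subspaces are spanned by columns, unlike the row spaces of [mxalgebra]. *)
Definition im_mx n r (Z : 'M[K]_(n, r)) : set 'cV[K]_n :=
  [set Z *m w | w in [set: 'cV[K]_r]].

Definition ker_mx p n (A : 'M[K]_(p, n)) : set 'cV[K]_n :=
  [set v | A *m v = 0].

End Matrices.

(* Elements of L^2([0,T], K^n) are represented by functions K -> 'cV[K]_n, of
   which only the restriction to [0,T], up to Lebesgue-null sets, matters. *)
Section FunctionSpaces.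
Context {K : realType}.
Local Notation mu := (@lebesgue_measure K).
Implicit Types (T omega : K) (n : nat).

Definition mulmxf p n (A : 'M[K]_(p, n)) (f : K -> 'cV[K]_n) : K -> 'cV[K]_p :=
  fun t => A *m f t.

Definition aeq T n (f g : K -> 'cV[K]_n) : Prop :=
  f = g %[ae mu in [set` `[0, T]]].

Definition L2 T {n} : set (K -> 'cV[K]_n) :=
  [set f : K -> 'cV[K]_n |
    (forall i, measurable_fun `[0, T] (fun t => f t i ord0)) /\
    (\int[mu]_(t in `[0%R, T]) (enorm (f t) ^+ 2)%:E < +oo)%E].

Definition L2norm T n (f : K -> 'cV[K]_n) : K :=
  Num.sqrt (\int[mu]_(t in `[0, T]) enorm (f t) ^+ 2).

Definition L2w T omega {n} : set (K -> 'cV[K]_n) :=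
  [set f : K -> 'cV[K]_n | L2 T (fun t => expR (- omega * t) *: f t)].

Definition L2wnorm T omega n (f : K -> 'cV[K]_n) : K :=
  Num.sqrt (\int[mu]_(t in `[0, T])
              (expR (- 2 * omega * t) * enorm (f t) ^+ 2)).

(* C_c^infty(0,T) *)
Definition test_function T (phi : K -> K) : Prop :=
  (forall k t, derivable (derive1n k phi) t 1) /\
  exists a b : K, [/\ 0 < a, b < T & forall t, t \notin `[a, b] -> phi t = 0].

Definition is_weak_deriv T n (f g : K -> 'cV[K]_n) : Prop :=
  forall phi, test_function T phi -> forall i,
    \int[mu]_(t in `[0, T]) (f t i ord0 * derive1 phi t) =
    - \int[mu]_(t in `[0, T]) (g t i ord0 * phi t).

Definition H1 T {n} : set (K -> 'cV[K]_n) :=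
  [set f : K -> 'cV[K]_n | L2 T f /\ exists g, L2 T g /\ is_weak_deriv T f g].

(* The weak derivative of f, for f in H^1; unique up to null sets. *)
Definition wderiv T n (f : K -> 'cV[K]_n) : K -> 'cV[K]_n :=
  xget (cst 0) [set g : K -> 'cV[K]_n | L2 T g /\ is_weak_deriv T f g].

(* The continuous representative of f, for f in H^1; unique on [0,T]. *)
Definition crep T n (f : K -> 'cV[K]_n) : K -> 'cV[K]_n :=
  xget f [set F : K -> 'cV[K]_n | {within `[0, T], continuous F} /\ aeq T F f].

End FunctionSpaces.

(* [Jc i j] is the coupling block in position (i, j) and is used only for
   i < j; the blocks below the diagonal are determined by skew-symmetry. *)
Record phdae_data (K : realType) := PHDAEData {
  horizon : K;
  nsub : nat;
  nsize : 'I_nsub -> nat;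
  nin : nat;
  Eb : forall i, 'M[K]_(nsize i);
  Jb : forall i, 'M[K]_(nsize i);
  Rb : forall i, 'M[K]_(nsize i);
  Qb : forall i, 'M[K]_(nsize i);
  Jc : forall i j, 'M[K]_(nsize i, nsize j);
  Bb : forall i, 'M[K]_(nsize i, nin);
  input : K -> 'cV[K]_nin;
  xinit : 'cV[K]_(\sum_(i < nsub) nsize i)
}.
Arguments nsize {K} d i : rename.
Arguments Eb {K} d i : rename.
Arguments Jb {K} d i : rename.
Arguments Rb {K} d i : rename.
Arguments Qb {K} d i : rename.
Arguments Jc {K} d i j : rename.
Arguments Bb {K} d i : rename.
Arguments input {K} d t : rename.

Section CoupledPHDAE.
Context {K : realType} (d : phdae_data K).

Definition phdim : nat := (\sum_(i < nsub d) nsize d i)%N.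

Definition matE : 'M[K]_phdim := \mxdiag_(i < nsub d) Eb d i.
Definition matR : 'M[K]_phdim := \mxdiag_(i < nsub d) Rb d i.
Definition matQ : 'M[K]_phdim := \mxdiag_(i < nsub d) Qb d i.
Definition matB : 'M[K]_(phdim, nin d) := \mxcol_(i < nsub d) Bb d i.
Definition matJ : 'M[K]_phdim :=
  \mxdiag_(i < nsub d) Jb d i
  + \mxblock_(i < nsub d, j < nsub d)
      (if (i < j)%N then Jc d i j
       else if (j < i)%N then - (Jc d j i)^T else 0).

Definition matJd : 'M[K]_phdim := \mxdiag_(i < nsub d) Jb d i.
Definition matJo : 'M[K]_phdim := matJ - matJd.

Definition block_structure : Prop :=
  forall i : 'I_(nsub d),
    [/\ psdmx (Rb d i), (Jb d i)^T = - Jb d i,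
        (Eb d i)^T *m Qb d i = (Qb d i)^T *m Eb d i,
        psdmx ((Eb d i)^T *m Qb d i) & Qb d i \in unitmx].

Definition rank_condition : Prop :=
  \rank (row_mx matE (row_mx matR matJ)) = phdim.

Definition consistency r r1
    (Z : 'M[K]_(phdim, r)) (Z1 : 'M[K]_(r, r1)) : Prop :=
  [/\ \rank Z = r, \rank Z1 = r1, im_mx Z = ker_mx matE &
      im_mx Z1 = ker_mx (matR *m matQ *m Z)
                 `&` ker_mx (Z^T *m matQ^T *m matJ *m matQ *m Z)] /\
  let ZQ := Z1^T *m Z^T *m matQ^T in
  H1 (horizon d) (mulmxf (ZQ *m matB) (input d)) /\
  ZQ *m matJ *m matQ *m xinit d
    + crep (horizon d) (mulmxf (ZQ *m matB) (input d)) 0 = 0.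

Definition coupled_phdae : Prop :=
  [/\ 0 < horizon d, block_structure, rank_condition, L2 (horizon d) (input d) &
      exists r r1 (Z : 'M[K]_(phdim, r))
        (Z1 : 'M[K]_(r, r1)), consistency Z Z1].

Definition weak_solution (x : K -> 'cV[K]_phdim) : Prop :=
  [/\ L2 (horizon d) x, H1 (horizon d) (mulmxf matE x),
      crep (horizon d) (mulmxf matE x) 0 = matE *m xinit d &
      aeq (horizon d) (wderiv (horizon d) (mulmxf matE x))
                (fun t => (matJ - matR) *m matQ *m x t + matB *m input d t)].

Variables (alpha mu omega : K).

Definition opM (x : K -> 'cV[K]_phdim) : K -> 'cV[K]_phdim := fun t =>
  wderiv (horizon d) (mulmxf matE x) t
  - (matJd - alpha *: matR + mu *: (matE *m invmx matQ)) *m matQ *m x t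
  - matB *m input d t.

Definition domM : set (K -> 'cV[K]_phdim) :=
  [set x : K -> 'cV[K]_phdim |
    [/\ L2w (horizon d) omega x, H1 (horizon d) (mulmxf matE x) &
        crep (horizon d) (mulmxf matE x) 0 = matE *m xinit d]].

Definition opN (x : K -> 'cV[K]_phdim) : K -> 'cV[K]_phdim := fun t =>
  ((1 - alpha) *: matR + mu *: (matE *m invmx matQ) - matJo) *m matQ *m x t.

Definition opMQ (v : K -> 'cV[K]_phdim) := opM (mulmxf (invmx matQ) v).
Definition opNQ (v : K -> 'cV[K]_phdim) := opN (mulmxf (invmx matQ) v).

Definition domMQ : set (K -> 'cV[K]_phdim) := [set mulmxf matQ x | x in domM].

(* I + c A *)
Definition id_plus (c : K) (A : (K -> 'cV[K]_phdim) -> (K -> 'cV[K]_phdim)) :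
    (K -> 'cV[K]_phdim) -> (K -> 'cV[K]_phdim) :=
  fun v t => v t + c *: A v t.

(* w = A^{-1} v in L^2, for an operator A with domain D.  The operators inverted
   below are bijective, so that w is determined up to null sets. *)
Definition inverse_at (D : set (K -> 'cV[K]_phdim))
    (A : (K -> 'cV[K]_phdim) -> (K -> 'cV[K]_phdim)) (v w : K -> 'cV[K]_phdim) :
    Prop :=
  D w /\ aeq (horizon d) (A w) v.

(* x' = Q^{-1} (I + lambda M Q^{-1})^{-1} (I - lambda N Q^{-1})
          (I + lambda N Q^{-1})^{-1} (I - lambda M Q^{-1}) Q x *)
Definition iteration_step (lambda : K) (x x' : K -> 'cV[K]_phdim) : Prop :=
  exists y w : K -> 'cV[K]_phdim,
    [/\ inverse_at (L2w (horizon d) omega) (id_plus lambda opNQ)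
          (id_plus (- lambda) opMQ (mulmxf matQ x)) y,
        inverse_at domMQ (id_plus lambda opMQ) (id_plus (- lambda) opNQ y) w &
        x' = mulmxf (invmx matQ) w].

End CoupledPHDAE.

Arguments weak_solution {K} d x.
Arguments opM {K} d alpha mu x t.
Arguments opN {K} d alpha mu x t.
Arguments opMQ {K} d alpha mu v t.
Arguments opNQ {K} d alpha mu v t.
Arguments domM {K} d omega x.
Arguments domMQ {K} d omega v.
Arguments iteration_step {K} d alpha mu omega lambda x x'.

(* Main.v *)
(* Write q^k = Q (x^k - x), S = E Q^-1 and A for the matrix of N Q^-1.  With
   D^k = M x^k - M x and v^k the difference of (I + lambda N Q^-1)^-1
   (I - lambda M Q^-1) Q x^k and Q x, one step of the iteration reads, for almost
   every t,
     z^k - z = q + lambda D,   v + lambda A v = q - lambda D,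
     z^(k+1) - z = v - lambda A v,
   so that pointwise
     |z^(k+1) - z|^2 = |z^k - z|^2 - 4 lambda <q, D> - 4 lambda <v, A v>
   with <v, A v> >= 0.  Since q^T (S q)' is half the derivative of q^T S q,
     int_0^t e^(-2 omega s) <q, D> = e^(-2 omega t) q(t)^T S q(t) / 2
       + int_0^t e^(-2 omega s) ((omega - mu) q^T S q + alpha q^T R q).
   All of this holds on [0, t] for every t, and summing over k bounds
   sum_k q^k(t)^T S q^k(t) uniformly in t and sum_k int_0^T alpha q^T R q; hence
   (a), (b) and (c).  The pointwise values and the product rule come from the
   du Bois-Reymond lemma: a function with an integrable weak derivative agrees
   almost everywhere with a primitive of that derivative. *)

Require Import Defs.
From mathcomp Require Import all_boot all_order all_algebra.
From mathcomp Require Import all_classical all_reals all_analysis.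
From mathcomp Require Import measurable_realfun ring lra.
Set Implicit Arguments.
Unset Strict Implicit.
Unset Printing Implicit Defensive.
Import Order.TTheory GRing.Theory Num.Theory.
Import numFieldNormedType.Exports.
Local Open Scope classical_set_scope.
Local Open Scope ring_scope.

(** * A smooth step *)

(** As E may be singular, q^k is only square integrable, so q^T S q cannot be differentiated as a
    product of q and S q. A positive semidefinite G with S G S = S removes this obstacle: with F = S
    q one has q^T S q = F^T G F, which involves only absolutely continuous coordinates. Since F
    stays in the range of S, so does its derivative f almost everywhere, and 2 f^T G F collapses to
    2 q^T f. The same G yields |F|^2 <= tr S F^T G F, so the energy controls F at every single time.
    The derivatives are merely integrable; the product rule is therefore obtained from a quadratic
    bound on increments and not from classical calculus. Because M x = - N x, the solution is a
    fixed point of the iteration, with Q x as intermediate function. Taking differences removes B u,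
    and the common initial value gives F 0 = 0, hence no boundary term at time 0. The skew parts Jd
    and Jo are invisible to the quadratic forms. The shift mu E Q^-1 adds mu q^T S q to N at the
    expense of M, where the weight e^(-2 omega t) with omega >= mu pays for it. *)

Section SmoothStep.
Context {K : realType}.
Implicit Types (f g : K -> K) (m n : nat) (a b t : K).

(** Recursion on the derivative makes closure under sums, products and inverses a short induction on
    m; having it for all m gives the smoothness that [test_function] asks for. *)
Fixpoint diffn m f : Prop :=
  if m is m'.+1 then (forall t, derivable f t 1) /\ diffn m' (derive1 f)
  else True.

Lemma diffn_intro m f g :
  (forall t, is_derive t 1 f (g t)) -> diffn m g -> diffn m.+1 f.
Proof.
move=> fg mg; split; first by move=> t; have [] := fg t.
suff -> : f^`()%classic = g by [].
by apply/funext => t; rewrite derive1E derive_val.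
Qed.

Lemma diffn_is_derive m f t : diffn m.+1 f -> is_derive t 1 f (f^`()%classic t).
Proof. by move=> [df _]; rewrite derive1E; apply: derivableP. Qed.

Lemma diffnW m f : diffn m.+1 f -> diffn m f.
Proof.
elim: m f => [//|m IH] f [df dm]; split=> //.
exact: IH.
Qed.

Lemma diffnD m f g : diffn m f -> diffn m g -> diffn m (f + g).
Proof.
elim: m f g => [//|m IH] f g df dg.
apply: (@diffn_intro _ _ (f^`()%classic + g^`()%classic)) => [t|].
  by apply: is_deriveD; apply: diffn_is_derive; eassumption.
by apply: IH; [case: df|case: dg].
Qed.

Lemma diffnM m f g : diffn m f -> diffn m g -> diffn m (f * g).
Proof.
elim: m f g => [//|m IH] f g df dg.
apply: (@diffn_intro _ _ (f * g^`()%classic + g * f^`()%classic)) => [t|].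
  by apply: is_deriveM; apply: diffn_is_derive; eassumption.
by apply: diffnD; apply: IH; solve [exact: diffnW|case: df => //|case: dg => //].
Qed.

Lemma diffn_cst m a : diffn m (cst a).
Proof.
elim: m a => [//|m IH] a; exact: (@diffn_intro _ _ (cst 0)).
Qed.

Lemma diffn_affine m f a b : diffn m f -> diffn m (fun t => f (a * t + b)).
Proof.
elim: m f => [//|m IH] f df.
apply: (@diffn_intro _ _ ((cst a) * (fun t => f^`()%classic (a * t + b)))) => [t|].
  have hg : is_derive t 1 (fun t => a * t + b) (a : K).
    have -> : (fun t => a * t + b) = (a \*: id + cst b) :> (K -> K).
      by apply/funext.
    by apply: is_derive_eq; rewrite addr0 /GRing.scale /= mulr1.
  have := @is_derive1_comp _ f (fun t => a * t + b) t _ _ (diffn_is_derive _ df) hg.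
  by move=> H; apply: is_derive_eq H _; rewrite /= mulrC.
apply: diffnM; first exact: diffn_cst.
by apply: IH; case: df.
Qed.

(** The derivative - f' g^2 of g = 1/f contains g again, so order m of g feeds order m + 1. *)
Lemma diffnV m f : (forall t, f t != 0) -> diffn m f ->
  diffn m (fun t => (f t)^-1).
Proof.
move=> f0; elim: m => [//|m IH] df.
have {}IH := IH (diffnW df).
pose g t := (f t)^-1.
apply: (@diffn_intro m g (fun t => -1 * (f^`()%classic t * (g t * g t)))) => [t|].
  have hf := diffn_is_derive t df.
  have := is_deriveV (f0 t) hf.
  move=> H; apply: is_derive_eq H _.
  by rewrite /g /GRing.scale /= expr2 invfM; ring.
apply: (@diffnM m (cst (-1))); first exact: diffn_cst.
apply: diffnM; first by case: df.
exact: (@diffnM m g g).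
Qed.

Lemma diffn_derivable_derive1n f : (forall m, diffn m f) ->
  forall k t, derivable (derive1n k f) t 1.
Proof.
move=> df k; elim: k f df => [|k IH] f df t; first by have [] := df 1%N.
rewrite /derive1n iterSr; apply: IH => m.
by have [] := df m.+1.
Qed.

(* The functions t^-n exp(-1/t) are closed, up to linear combinations, under
   differentiation. *)
Definition flat n t := if 0 < t then t^-1 ^+ n * expR (- t^-1) else 0.

Lemma flat_ge0 n t : 0 <= flat n t.
Proof.
rewrite /flat; case: ifPn => // t0.
by rewrite mulr_ge0 ?expR_ge0// exprn_ge0// invr_ge0 ltW.
Qed.

Lemma flat_gt0 n t : 0 < t -> 0 < flat n t.
Proof. by move=> t0; rewrite /flat t0 mulr_gt0 ?expR_gt0// exprn_gt0// invr_gt0. Qed.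

Lemma flat_eq0 n t : t <= 0 -> flat n t = 0.
Proof. by move=> t0; rewrite /flat ltNge t0. Qed.

(** This is exp s >= s^(n+2) / (n+2)! at s = 1/t. The exponent 2 leaves a factor |h| in the
    difference quotient at the origin, so the derivative there is 0. *)
Lemma flat_le n t : `|flat n t| <= (n.+2)`!%:R * t ^+ 2.
Proof.
rewrite ger0_norm ?flat_ge0//; have [t0|t0] := ltP 0 t; last first.
  by rewrite flat_eq0// mulr_ge0// sqr_ge0.
rewrite /flat t0.
have s0 : 0 <= t^-1 by rewrite invr_ge0 ltW.
have H : t^-1 ^+ n.+2 / (n.+2)`!%:R <= expR t^-1.
  by apply: le_trans (expR_ge1Dxn n.+1 s0); rewrite lerDr.
have fn0 : 0 < (n.+2)`!%:R :> K by rewrite ltr0n fact_gt0.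
rewrite expRN ler_pdivrMr ?expR_gt0//.
have -> : t^-1 ^+ n = t ^+ 2 * t^-1 ^+ n.+2.
  by rewrite -[n.+2]addn2 exprD [RHS]mulrCA -exprMn divff ?gt_eqF// expr1n mulr1.
rewrite [leRHS]mulrAC [leRHS]mulrC ler_wpM2l ?sqr_ge0//.
by rewrite mulrC -ler_pdivrMr.
Qed.

Lemma is_derive_flat n t :
  is_derive t 1 (flat n) (- n%:R * flat n.+1 t + flat n.+2 t).
Proof.
have [t0|t0|->] := ltgtP t 0.
- rewrite !flat_eq0 ?(ltW t0)// mulr0 addr0.
  apply: (@near_eq_is_derive _ _ _ (cst 0)).
  near=> s; rewrite flat_eq0//.
  by apply: ltW; near: s; exact: lt_nbhsl.
- rewrite /flat t0.
  apply: (@near_eq_is_derive _ _ _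
     ((fun t => t^-1) ^+ n * (expR \o (fun t => - t^-1)))).
    near=> s; rewrite !fctE /=; have -> // : 0 < s.
    near: s; exact: lt_nbhsr.
  have tn0 : (id t : K) != 0 by rewrite gt_eqF.
  have dV := @is_deriveV _ id t _ 1 tn0 (is_derive_id t 1).
  have dN := is_deriveN dV.
  have dE := @is_derive1_comp _ expR _ t _ _ (is_derive_expR _) dN.
  have dX := is_deriveX n dV.
  have := is_deriveM dX dE.
  move=> H; apply: is_derive_eq H _.
  rewrite /GRing.scale /= /id !fctE /=.
  rewrite !mulr1 -exprVn; case: n {dX} => [|n] /=.
    by rewrite mulr0n oppr0 !mul0r mulr0 addr0 add0r expr0 mul1r opprK mulrC.
  by rewrite !exprS expr0; ring.
- rewrite !flat_eq0// mulr0 addr0.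
  suff H : h^-1 *: (flat n (h *: 1 + 0) - flat n 0) @[h --> 0^'] --> (0:K).
    split; last exact: cvg_lim H.
    by apply/cvg_ex; exists 0.
  apply/cvgr0Pnorm_le => e e0; near=> h.
  rewrite (flat_eq0 n (lexx 0)) subr0 addr0 /GRing.scale/= mulr1 normrM normfV.
  have h0 : h != 0 by near: h; exact: nbhs_dnbhs_neq.
  rewrite ler_pdivrMl ?normr_gt0//.
  apply: le_trans (flat_le n h) _.
  rewrite -(@real_normK _ h) ?num_real// expr2 mulrA mulrC ler_wpM2l//.
  rewrite -ler_pdivlMl ?ltr0n ?fact_gt0//.
  near: h; apply: dnbhs0_le.
  by rewrite mulr_gt0// invr_gt0 ltr0n fact_gt0.
Unshelve. all: by end_near. Qed.

Lemma diffn_flat m n : diffn m (flat n).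
Proof.
elim: m n => [//|m IH] n.
apply: (@diffn_intro _ _ ((cst (- n%:R)) * flat n.+1 + flat n.+2)) => [t|].
  exact: is_derive_flat.
apply: diffnD => //; apply: diffnM => //; exact: diffn_cst.
Qed.

(** The classical smooth transition from 0 to 1 on [0, 1]; since t and 1 - t are never both
    nonpositive, the denominator does not vanish. *)
Definition smooth_step t : K := flat 0 t / (flat 0 t + flat 0 (1 - t)).

Lemma smooth_step_den t : 0 < flat 0 t + flat 0 (1 - t).
Proof.
have [t0|t0] := ltP 0 t; first by rewrite ltr_pwDl ?flat_gt0 ?flat_ge0.
by rewrite ltr_wpDl ?flat_ge0// flat_gt0//; lra.
Qed.

Lemma smooth_step_eq0 t : t <= 0 -> smooth_step t = 0.
Proof. by move=> t0; rewrite /smooth_step flat_eq0// mul0r. Qed.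

Lemma smooth_step_eq1 t : 1 <= t -> smooth_step t = 1.
Proof.
move=> t1; rewrite /smooth_step [flat 0 (1 - t)]flat_eq0 ?subr_le0// addr0.
by rewrite divff// gt_eqF// flat_gt0//; lra.
Qed.

Lemma smooth_step_ge0 t : 0 <= smooth_step t.
Proof. by rewrite divr_ge0 ?flat_ge0// ltW// smooth_step_den. Qed.

Lemma smooth_step_le1 t : smooth_step t <= 1.
Proof.
by rewrite ler_pdivrMr ?smooth_step_den// mul1r lerDl flat_ge0.
Qed.

Lemma diffn_smooth_step m : diffn m smooth_step.
Proof.
apply: (@diffnM m (flat 0) (fun t => (flat 0 t + flat 0 (1 - t))^-1)).
  exact: diffn_flat.
apply: diffnV => [t|]; first by rewrite gt_eqF// smooth_step_den.
apply: (@diffnD m (flat 0) (fun t => flat 0 (1 - t))); first exact: diffn_flat.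
have -> : (fun t => flat 0 (1 - t)) = (fun t => flat 0 (-1 * t + 1)).
  by apply/funext => t; congr flat; ring.
exact/diffn_affine/diffn_flat.
Qed.

Lemma derive1_continuous_diffn f : diffn 2 f -> continuous (f^`()%classic).
Proof.
move=> [_ [df _]] t.
by apply/differentiable_continuous/derivable1_diffP.
Qed.

Lemma derive1_near_cst f a t : (\forall s \near t, f s = a) ->
  f^`()%classic t = 0.
Proof.
move=> fa; rewrite derive1E (@near_eq_derive _ _ _ f (cst a)) //.
exact: derive_cst.
Qed.

Lemma derive1_smooth_step_eq0 t : (t < 0) || (1 < t) ->
  smooth_step^`()%classic t = 0.
Proof.
case/orP => t0.
- apply: (@derive1_near_cst _ 0); near=> s; apply: smooth_step_eq0.
  by apply: ltW; near: s; exact: lt_nbhsl.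
- apply: (@derive1_near_cst _ 1); near=> s; apply: smooth_step_eq1.
  by apply: ltW; near: s; exact: lt_nbhsr.
Unshelve. all: by end_near. Qed.

Lemma derive1_smooth_step_bounded :
  exists2 M, 0 < M & forall t, `|smooth_step^`()%classic t| <= M.
Proof.
have cs := derive1_continuous_diffn (diffn_smooth_step 2).
have ci : {within `[0, 1], continuous (fun t => `|smooth_step^`()%classic t|)}.
  apply: continuous_subspaceT => t.
  apply: continuous_comp; first exact: cs.
  exact: norm_continuous.
have [c c01 hc] := EVT_max ler01 ci.
exists (`|smooth_step^`()%classic c| + 1); first by rewrite ltr_pwDr.
move=> t; have [t01|t01] := boolP (t \in `[0, 1]).
  by apply: le_trans (hc t t01) _; rewrite lerDl.
rewrite derive1_smooth_step_eq0 ?normr0 ?addr_ge0//.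
by move: t01; rewrite in_itv/= negb_and -!ltNge.
Qed.

End SmoothStep.

(** * Weak derivatives on an interval *)

Section WeakDerivative.
Context {K : realType}.
Local Notation mu := (@lebesgue_measure K).
Implicit Types (a b c t T : K) (f g h : K -> K).

Definition intg a b f := mu.-integrable `[a, b] (EFin \o f).

Lemma intg_measurable a b f : intg a b f -> measurable_fun `[a, b] f.
Proof. by move=> /measurable_int /measurable_EFinP. Qed.

Lemma intgS a b c f : a <= c <= b -> intg a b f -> intg a c f.
Proof.
move=> /andP[ac cb]; apply: integrableS => //.
by apply: subset_itvl; rewrite bnd_simp.
Qed.

Lemma intgSl a b c f : a <= c <= b -> intg a b f -> intg c b f.
Proof.
move=> /andP[ac cb]; apply: integrableS => //.
by apply: subset_itvr; rewrite bnd_simp.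
Qed.

Lemma intgD a b f g : intg a b f -> intg a b g -> intg a b (fun t => f t + g t).
Proof. by move=> /integrableD; apply. Qed.

Lemma intgB a b f g : intg a b f -> intg a b g -> intg a b (fun t => f t - g t).
Proof. by move=> /integrableB; apply. Qed.

Lemma intgZ a b k f : intg a b f -> intg a b (fun t => k * f t).
Proof. by move=> /(integrableZl _ k); apply. Qed.

Lemma intg_eq a b f g : {in `[a, b], f =1 g} -> intg a b f -> intg a b g.
Proof.
move=> fg; apply: eq_integrable => // t; rewrite inE => tab.
by rewrite /= fg.
Qed.

Lemma intg0 a b : intg a b (fun=> 0).
Proof. exact: integrable0. Qed.

Lemma intg_sum a b I (r : seq I) (f : I -> K -> K) :
  (forall i, intg a b (f i)) -> intg a b (fun t => \sum_(i <- r) f i t).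
Proof.
move=> fi; elim: r => [|i r IH].
  by apply: intg_eq (intg0 a b) => t _; rewrite big_nil.
by apply: intg_eq (intgD (fi i) IH) => t _; rewrite big_cons.
Qed.

Lemma intgM_bounded a b f h M : intg a b f -> measurable_fun `[a, b] h ->
  (forall t, t \in `[a, b] -> `|h t| <= M) -> intg a b (fun t => f t * h t).
Proof.
move=> fi mh hM; apply: (integrableMl _ fi mh) => //.
exists M; split; first exact: num_real.
by move=> x Mx t tab; apply: (le_trans (hM t tab)); exact: ltW.
Qed.

Lemma within_continuous_bounded a b h : a <= b ->
  {within `[a, b], continuous h} ->
  exists M, forall t, t \in `[a, b] -> `|h t| <= M.
Proof.
move=> ab ch; have [c1 _ h1] := EVT_max ab ch; have [c2 _ h2] := EVT_min ab ch.
exists (`|h c1| + `|h c2|) => t tab; have := h1 t tab; have := h2 t tab.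
move=> A B; rewrite ler_norml; apply/andP; split.
  rewrite lerNl (le_trans (_ : _ <= `|h c2|)) ?lerDr//.
  by rewrite -(normrN (h c2)) (le_trans _ (ler_norm _))// lerN2.
by rewrite (le_trans B)// (le_trans (ler_norm _))// lerDl.
Qed.

Lemma within_continuous_measurable a b h :
  {within `[a, b], continuous h} -> measurable_fun `[a, b] h.
Proof. by move=> ch; apply: subspace_continuous_measurable_fun. Qed.

Lemma intgM_continuous a b f h : a <= b -> intg a b f ->
  {within `[a, b], continuous h} -> intg a b (fun t => f t * h t).
Proof.
move=> ab fi ch; have [M hM] := within_continuous_bounded ab ch.
exact: intgM_bounded fi (within_continuous_measurable ch) hM.
Qed.

Lemma intg_continuous a b h : {within `[a, b], continuous h} -> intg a b h.
Proof. by apply: continuous_compact_integrable; exact: segment_compact. Qed.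

Lemma intg_le a b f g : intg a b g -> measurable_fun `[a, b] f ->
  (forall t, t \in `[a, b] -> `|f t| <= g t) -> intg a b f.
Proof.
move=> gi mf fg; apply: le_integrable gi => //; first exact/measurable_EFinP.
move=> t tab; rewrite /= lee_fin; apply: le_trans (fg t tab) _.
exact: ler_norm.
Qed.

Lemma ae_imp (P Q : K -> Prop) : {ae mu, forall t, P t} ->
  (forall t, P t -> Q t) -> {ae mu, forall t, Q t}.
Proof.
move=> aP PQ; apply: filterS aP => //.
exact: (ae_filter_ringOfSetsType mu).
Qed.

Lemma ae_imp2 (P P' Q : K -> Prop) : {ae mu, forall t, P t} ->
  {ae mu, forall t, P' t} -> (forall t, P t -> P' t -> Q t) ->
  {ae mu, forall t, Q t}.
Proof.
move=> aP aP' PQ; apply: filterS2 aP aP' => //.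
exact: (ae_filter_ringOfSetsType mu).
Qed.

Lemma ae_neq a : {ae mu, forall t, t != a}.
Proof.
exists [set a]; split; [exact: measurable_set1|exact: lebesgue_measure_set1|].
by move=> t /= /negP; rewrite negbK => /eqP.
Qed.

Lemma ae_exists a b (P : K -> Prop) : a < b -> {ae mu, forall t, P t} ->
  exists t, a < t < b /\ P t.
Proof.
move=> ab [N [mN N0 PN]]; apply: contrapT => nP.
have sub : `]a, b[ `<=` N.
  move=> t /=; rewrite in_itv/= => tab; apply: PN => /= Pt.
  by apply: nP; exists t.
have : (mu `]a, b[ <= mu N)%E by rewrite le_measure ?inE.
rewrite N0 lebesgue_measure_itv/= lte_fin ab -EFinB lee_fin.
by apply/negP; rewrite -ltNge subr_gt0.
Qed.

Lemma ae_Rintegral a b f g : intg a b f -> measurable_fun `[a, b] g ->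
  {ae mu, forall t, t \in `[a, b] -> f t = g t} ->
  intg a b g /\ \int[mu]_(t in `[a, b]) f t = \int[mu]_(t in `[a, b]) g t.
Proof.
move=> fi mg fg.
have fg' : ae_eq mu [set` `[a, b]] (EFin \o f) (EFin \o g).
  by apply: (ae_imp fg) => t H /= tab; rewrite H.
have mf := intg_measurable fi.
split; last first.
  by congr fine; apply: ae_eq_integral fg' => //; exact/measurable_EFinP.
apply/integrableP; split; first exact/measurable_EFinP.
have /integrableP[_] := fi; congr (_ < _)%E.
apply: ge0_ae_eq_integral => //.
- by apply/measurableT_comp => //; exact/measurable_EFinP.
- by apply/measurableT_comp => //; exact/measurable_EFinP.
- by apply: (ae_imp fg) => t H /= tab; rewrite H.
Qed.

Lemma near_natSinv_lt e : 0 < e -> \forall n \near \oo, n.+1%:R^-1 < e :> K.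
Proof. by move=> e0; exact: (near_infty_natSinv_lt (PosNum e0)). Qed.

(** A ramp climbing on [a, a + 1/(n+1)]: it approximates the indicator of t > a, and its derivative
    a unit mass at a, approached from the right. *)
Definition steep n a t : K := smooth_step (n.+1%:R * (t - a)).

Lemma diffn_steep m n a : diffn m (steep n a).
Proof.
have -> : steep n a = (fun t => smooth_step (n.+1%:R * t + - (n.+1%:R * a))).
  by apply/funext => t; rewrite /steep mulrBr.
exact/diffn_affine/diffn_smooth_step.
Qed.

Lemma derive1_steep n a t : (steep n a)^`()%classic t =
  n.+1%:R * smooth_step^`()%classic (n.+1%:R * (t - a)).
Proof.
have hg : is_derive t 1 (fun t => n.+1%:R * (t - a)) (n.+1%:R : K).
  have -> : (fun t => n.+1%:R * (t - a)) = n.+1%:R \*: (id - cst a) :> (K -> K).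
    by apply/funext.
  by apply: is_derive_eq; rewrite subr0 /GRing.scale /= mulr1.
have H := @is_derive1_comp _ smooth_step (fun t => n.+1%:R * (t - a)) t _ _
  (diffn_is_derive (n.+1%:R * (t - a)) (diffn_smooth_step 1)) hg.
by rewrite derive1E (@derive_val _ _ _ _ _ _ _ H) mulrC.
Qed.

Lemma continuous_steep n a : continuous (steep n a).
Proof.
move=> t; apply/differentiable_continuous/derivable1_diffP.
by have [] := diffn_steep 1 n a.
Qed.

Lemma continuous_derive1_steep n a : continuous (steep n a)^`()%classic.
Proof. exact/derive1_continuous_diffn/diffn_steep. Qed.

Lemma steep_bound n a t : `|steep n a t| <= 1.
Proof. by rewrite ger0_norm ?smooth_step_ge0// smooth_step_le1. Qed.

Lemma Rintegral_derive1_steep T n a : 0 < a < T -> 1 <= n.+1%:R * (T - a) ->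
  \int[mu]_(t in `[0, T]) (steep n a)^`()%classic t = 1.
Proof.
move=> /andP[a0 aT] nT.
rewrite /Rintegral (@continuous_FTC2 _ _ (steep n a)) //=; last first.
- have cs := @continuous_steep n a.
  split; first by move=> t _; have [] := diffn_steep 1 n a.
  + exact/cvg_at_right_filter/cs.
  + exact/cvg_at_left_filter/cs.
- exact/continuous_subspaceT/continuous_derive1_steep.
- exact: lt_trans aT.
rewrite /steep smooth_step_eq1// smooth_step_eq0 ?subr0//.
by rewrite sub0r mulrN oppr_le0 mulr_ge0// ltW.
Qed.

(** For large n the kernel has mass 1, is bounded by (n+1) M and is supported in the ball of radius
    2/(n+1) around a, of length 4/(n+1). The error is thus at most 4 M times the average of |f - f
    a| on that ball, which tends to 0 at a Lebesgue point. *)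
Lemma lebesgue_pt_Rintegral_derive1_steep T f a : 0 < a < T -> intg 0 T f ->
  lebesgue_pt (f \_ `[0, T]) a ->
  \int[mu]_(t in `[0, T]) (f t * (steep n a)^`()%classic t)
    @[n --> \oo] --> f a.
Proof.
move=> /andP[a0 aT] fi La; have T0 : 0 < T by exact: lt_trans aT.
have [M M0 hM] := @derive1_smooth_step_bounded K.
set ft := f \_ `[0, T].
have fta : ft a = f a by rewrite /ft patchE mem_set//= in_itv/= !ltW.
have mft : measurable_fun setT ft.
  apply/(measurable_restrictT _ _).1 => //; exact: intg_measurable fi.
(* Radius 1/(n+1) would leave the right end of the ramp outside the open ball; the factor 2 gives
   the strict inequality that [derive1_smooth_step_eq0] asks for. *)
pose r n : K := 2 / n.+1%:R.
have r0 n : 0 < r n by rewrite /r divr_gt0.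
have est n : 1 <= n.+1%:R * (T - a) ->
    ((`|\int[mu]_(t in `[0, T]) (f t * (steep n a)^`()%classic t) - f a|)%:E <=
    (4 * M)%:E * davg ft a (r n))%E.
  move=> nT; pose k := (steep n a)^`()%classic.
  have ck : {within `[0, T], continuous k}.
    exact/continuous_subspaceT/continuous_derive1_steep.
  have k1 := Rintegral_derive1_steep (introT andP (conj a0 aT)) nT.
  have ik : intg 0 T k by exact: intg_continuous.
  have ifk := intgM_continuous (ltW T0) fi ck.
  have -> : f a = \int[mu]_(t in `[0, T]) (f a * k t).
    by rewrite RintegralZl// k1 mulr1.
  rewrite -RintegralB//; last exact: intgZ.
  have ii := intgB ifk (intgZ (f a) ik).
  rewrite EFin_normr_Rintegral//.
  apply: le_trans (le_abse_integral _ _ _) _ => //.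
    exact: (measurable_int _ ii).
  have mfta : measurable_fun [set: K] (fun y => ft y - ft a).
    exact: measurable_funB.
  rewrite /davg /iavg lebesgue_measure_ball ?(ltW (r0 n))// muleA inver.
  rewrite mulrn_eq0 /= gt_eqF// -EFinM.
  have -> : 4 * M * (r n *+ 2)^-1 = n.+1%:R * M.
    rewrite /r -mulr_natr; field; rewrite (_ : 1 + n%:R = n.+1%:R) ?pnatr_eq0//.
    by rewrite -natr1 addrC.
  have nM : 0 <= n.+1%:R * M by rewrite mulr_ge0 ?ltW.
  rewrite -ge0_integralZl//; [|exact: measurable_ball|]; last first.
    apply/measurable_EFinP/measurableT_comp => //.
    exact: measurable_funTS.
  rewrite [X in (X <= _)%E]integral_mkcond [X in (_ <= X)%E]integral_mkcond.
  apply: ge0_le_integral => //.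
  - by move=> t _; rewrite erestrict_ge0.
  - apply/(measurable_restrictT _ _).1 => //; apply/measurableT_comp => //.
    by apply/measurableT_comp => //; exact: intg_measurable ii.
  - apply/(measurable_restrictT _ _).1; first exact: measurable_ball.
    apply/measurable_EFinP/measurable_funM => //.
    by apply/measurableT_comp => //; exact: measurable_funTS.
  - move=> t _; rewrite !patchE; case: ifPn => [tT|_]; last first.
      by case: ifPn => // _; rewrite lee_fin mulr_ge0.
    have ftt : ft t = f t by rewrite /ft patchE tT.
    rewrite /= -mulrBl normrM ftt fta.
    rewrite /k derive1_steep; case: ifPn => tb.
      rewrite -EFinM lee_fin mulrC ler_wpM2r// normrM ger0_norm//.
      by rewrite ler_wpM2l.
    rewrite derive1_smooth_step_eq0 ?mulr0 ?normr0 ?mulr0//.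
    have : ~ ball a (r n) t by move=> H; move: tb; rewrite mem_set.
    rewrite /ball /= => /negP; rewrite -leNgt /r => H.
    have n0 : 0 < n.+1%:R :> K by [].
    have : 2 <= n.+1%:R * `|a - t| by rewrite mulrC -ler_pdivrMr.
    have [ta|ta] := leP a t.
      rewrite ler0_norm ?subr_le0// opprB => H2; apply/orP; right.
      by apply: lt_le_trans H2; rewrite ltr1n.
    rewrite gtr0_norm ?subr_gt0// => H2; apply/orP; left.
    by rewrite pmulr_rlt0// subr_lt0.
apply/cvgrPdist_le => e e0.
have Ta0 : 0 < T - a by rewrite subr_gt0.
have d20 d : 0 < d -> 0 < d / 2 :> K by move=> d0; rewrite divr_gt0.
have e4 : 0 < e / (4 * M) by rewrite divr_gt0// mulr_gt0.
have := La _ (@nbhs_open_ereal_lt _ 0 (fun=> e / (4 * M)) e4).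
case => d /= d0 dav.
near=> n.
rewrite distrC -lee_fin; apply: le_trans (est n _) _.
  rewrite -ler_pdivrMr// div1r -[leRHS]invrK lef_pV2 ?posrE ?invr_gt0//.
  by apply: ltW; near: n; exact: near_natSinv_lt.
apply: le_trans (_ : ((4 * M)%:E * (e / (4 * M))%:E <= _)%E).
  rewrite lee_pmul2l ?lte_fin ?mulr_gt0//; apply/ltW/dav => //=.
  rewrite sub0r normrN gtr0_norm// /r -ltr_pdivlMl// mulrC.
  by near: n; exact/near_natSinv_lt/d20.
by rewrite -EFinM lee_fin mulrCA divff ?mulr1// gt_eqF// mulr_gt0.
Unshelve. all: by end_near. Qed.

(** Dominated convergence with bound |g|: at each t the ramp is eventually constant, equal to 1 for
    t > a and to 0 for t <= a, the point a included. *)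
Lemma cvg_Rintegral_steep T g a : 0 <= a <= T -> intg 0 T g ->
  \int[mu]_(t in `[0, T]) (g t * steep n a t) @[n --> \oo] -->
  \int[mu]_(t in `]a, T]) g t.
Proof.
move=> /andP[a0 aT] gi.
have T0 : 0 <= T by exact: le_trans aT.
have sub : `]a, T] `<=` `[0, T].
  by move=> t /=; rewrite !in_itv/= => /andP[/ltW /(le_trans a0) -> ->].
have gs n : intg 0 T (fun t => g t * steep n a t).
  exact/(intgM_continuous T0 gi)/continuous_subspaceT/continuous_steep.
have mf : measurable_fun `[0, T] (EFin \o (g \_ `]a, T])).
  apply/measurable_EFinP/(measurable_restrict _ _ _).1 => //.
  rewrite setIidr//; apply: measurable_funS (intg_measurable gi) => //.
have := @dominated_convergence _ _ _ mu `[0, T]%classic _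
  (fun n => EFin \o (fun t => g t * steep n a t))
  (EFin \o (g \_ `]a, T])) (EFin \o (Num.norm \o g)) _ mf _ _ _.
case => //.
- by move=> n; exact: measurable_int (gs n).
- apply: nearW => t /=; rewrite in_itv/= => /andP[t0 tT].
  apply/cvg_EFin; first by apply: nearW.
  rewrite patchE; case: ifPn => [|tn].
    rewrite inE/= in_itv/= => /andP[ta _].
    have ta' : 0 < t - a by rewrite subr_gt0.
    apply: cvg_near_cst; near=> n => /=.
    rewrite /steep smooth_step_eq1 ?mulr1// -ler_pdivrMr ?subr_gt0// div1r.
    rewrite -[leRHS]invrK lef_pV2 ?posrE ?invr_gt0//; apply: ltW.
    by near: n; exact: near_natSinv_lt.
  apply: cvg_near_cst; apply: nearW => n /=.
  rewrite /steep smooth_step_eq0 ?mulr0// mulr_ge0_le0// subr_le0 leNgt.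
  by apply: contra tn => ta; rewrite inE/= in_itv/= ta.
- exact: integrable_norm.
- apply: nearW => t n _ /=; rewrite lee_fin normrM ler_piMr//.
  exact: steep_bound.
- move=> i1 _ cv.
have -> : \int[mu]_(t in `]a, T]) g t =
    \int[mu]_(t in `[0, T]) (g \_ `]a, T]) t.
  by rewrite -Rintegral_mkcondr setIidr.
apply: fine_cvg; rewrite fineK; last exact: integrable_fin_num.
exact: cv.
Unshelve. all: by end_near. Qed.

Lemma steep_test T n a b : 0 < a -> a < b -> b + n.+1%:R^-1 < T ->
  test_function T (fun t => steep n a t - steep n b t).
Proof.
move=> a0 ab bT; split.
  apply: diffn_derivable_derive1n => m.
  apply: (@diffnD _ _ (steep n a) (fun t => - steep n b t)).
    exact: diffn_steep.
  have -> : (fun t => - steep n b t) = cst (-1) * steep n b.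
    by apply/funext => t; rewrite !fctE mulN1r.
  by apply: diffnM; [exact: diffn_cst|exact: diffn_steep].
exists a, (b + n.+1%:R^-1); split => // t.
rewrite in_itv/= negb_and -!ltNge => /orP[ta|tb].
  rewrite /steep !smooth_step_eq0 ?subr0// mulr_ge0_le0// subr_le0 ltW//.
  exact: lt_trans ab.
have tb' : n.+1%:R^-1 <= t - b by rewrite lerBrDl ltW.
have nb : 1 <= n.+1%:R * (t - b) by rewrite mulrC -ler_pdivrMr// div1r.
rewrite /steep !smooth_step_eq1 ?subrr//.
by apply: le_trans nb _; rewrite ler_wpM2l// lerB// ltW.
Qed.

Lemma derive1_steepB n a b t :
  (fun t => steep n a t - steep n b t)^`()%classic t =
  (steep n a)^`()%classic t - (steep n b)^`()%classic t.
Proof.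
have da c := derivableP (proj1 (diffn_steep 1 n c) t).
have H := is_deriveB (da a) (da b).
by rewrite !derive1E (@derive_val _ _ _ _ _ _ _ H).
Qed.

(* Testing with a smooth plateau rising steeply at a and falling steeply at b
   gives f b - f a = \int_a^b g at any two Lebesgue points a < b. *)
Lemma weak_deriv_lebesgue_pt T f g a b : intg 0 T f -> intg 0 T g ->
  (forall phi, test_function T phi ->
    \int[mu]_(t in `[0, T]) (f t * derive1 phi t) =
    - \int[mu]_(t in `[0, T]) (g t * phi t)) ->
  0 < a -> a < b -> b < T ->
  lebesgue_pt (f \_ `[0, T]) a -> lebesgue_pt (f \_ `[0, T]) b ->
  f b - \int[mu]_(t in `[0, b]) g t = f a - \int[mu]_(t in `[0, a]) g t.
Proof.
move=> fi gi fg a0 ab bT La Lb.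
have b0 := lt_trans a0 ab; have aT := lt_trans ab bT.
have T0 := ltW (lt_trans b0 bT).
have ca := lebesgue_pt_Rintegral_derive1_steep (introT andP (conj a0 aT)) fi La.
have cb := lebesgue_pt_Rintegral_derive1_steep (introT andP (conj b0 bT)) fi Lb.
have ga := cvg_Rintegral_steep (introT andP (conj (ltW a0) (ltW aT))) gi.
have gb := cvg_Rintegral_steep (introT andP (conj (ltW b0) (ltW bT))) gi.
have sp c : 0 <= c -> c <= T -> \int[mu]_(t in `]c, T]) g t =
    \int[mu]_(t in `[0, T]) g t - \int[mu]_(t in `[0, c]) g t.
  by move=> c0 cT; rewrite Rintegral_itvB// bnd_simp.
rewrite !sp ?ltW// in ga gb.
(* [u n] is the weak identity for the plateau with all terms on one side, hence 0 once b + 1/(n+1) <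
   T; [L] is its limit. *)
pose L : K := f a - f b + (\int[mu]_(t in `[0, T]) g t -
  \int[mu]_(t in `[0, a]) g t -
  (\int[mu]_(t in `[0, T]) g t - \int[mu]_(t in `[0, b]) g t)).
pose u n := \int[mu]_(t in `[0, T]) (f t * (steep n a)^`()%classic t) -
  \int[mu]_(t in `[0, T]) (f t * (steep n b)^`()%classic t) +
  (\int[mu]_(t in `[0, T]) (g t * steep n a t) -
   \int[mu]_(t in `[0, T]) (g t * steep n b t)).
have cL : u n @[n --> \oo] --> L by apply: cvgD; apply: cvgB.
have : L = 0.
  apply: cvg_unique cL _ => //.
  have bT' : 0 < T - b by rewrite subr_gt0.
  apply: cvg_near_cst; near=> n; rewrite /u.
  have bn : b + n.+1%:R^-1 < T.
    by rewrite -ltrBrDl; near: n; exact: near_natSinv_lt.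
  have := fg _ (steep_test a0 ab bn).
  under eq_Rintegral do rewrite derive1_steepB mulrBr.
  under [X in _ = - X]eq_Rintegral do rewrite mulrBr.
  rewrite !RintegralB//; first by move=> ->; rewrite addNr.
  - exact/(intgM_continuous T0 gi)/continuous_subspaceT/continuous_steep.
  - exact/(intgM_continuous T0 gi)/continuous_subspaceT/continuous_steep.
  - exact/(intgM_continuous T0 fi)/continuous_subspaceT/continuous_derive1_steep.
  - exact/(intgM_continuous T0 fi)/continuous_subspaceT/continuous_derive1_steep.
rewrite /L => H; lra.
Unshelve. all: by end_near. Qed.

(** Almost every point is a Lebesgue point of f. One of them, a, is fixed inside (0, T) and
    determines c; comparison with a settles every other one, the two endpoints being a null set. *)
Lemma du_bois_reymond T f g : 0 < T -> intg 0 T f -> intg 0 T g ->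
  (forall phi, test_function T phi ->
    \int[mu]_(t in `[0, T]) (f t * derive1 phi t) =
    - \int[mu]_(t in `[0, T]) (g t * phi t)) ->
  exists c, {ae mu, forall t, t \in `[0, T] ->
    f t = c + \int[mu]_(s in `[0, t]) g s}.
Proof.
move=> T0 fi gi fg.
have lf : {ae mu, forall t, lebesgue_pt (f \_ `[0, T]) t}.
  exact/lebesgue_differentiation/integrable_locally.
have [a [/andP[a0 aT] La]] := ae_exists T0 lf.
exists (f a - \int[mu]_(s in `[0, a]) g s).
apply: ae_imp2 lf (ae_imp2 (ae_neq 0) (ae_neq T) (fun t => @conj _ _)) _.
move=> t Lt [t0 tT]; rewrite in_itv/= !le_eqVlt eq_sym (negbTE t0) (negbTE tT)/=.
move=> /andP[{}t0 {}tT].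
apply/eqP; rewrite -subr_eq; apply/eqP.
have [ta|at_|->//] := ltgtP t a.
- by rewrite (weak_deriv_lebesgue_pt fi gi fg t0 ta).
- by rewrite (weak_deriv_lebesgue_pt fi gi fg a0 at_).
Qed.

End WeakDerivative.

(** * Absolutely continuous functions *)

Section Primitives.
Context {K : realType}.
Local Notation mu := (@lebesgue_measure K).
Implicit Types (a b c s t T : K) (f g h F G H Phi : K -> K).

Lemma Rintegral_itv1 f a : \int[mu]_(t in `[a, a]) f t = 0.
Proof. by rewrite set_itv1 Rintegral_set1. Qed.

Lemma Rintegral_cc_split T f a b : intg 0 T f -> 0 <= a -> a <= b -> b <= T ->
  \int[mu]_(t in `[0, b]) f t - \int[mu]_(t in `[0, a]) f t =
  \int[mu]_(t in `[a, b]) f t.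
Proof.
move=> fi a0 ab bT; have b0 := le_trans a0 ab.
have fb : intg 0 b f by apply: intgS fi; rewrite b0.
rewrite Rintegral_itvB ?bnd_simp// Rintegral_itv_obnd_cbnd//.
apply: integrableS fb => //; apply: subset_itvr; rewrite bnd_simp//.
Qed.

(** Absolute continuity of F on [0, T] with density f, in integral form; f matters only up to null
    sets. *)
Definition primitive T F f :=
  intg 0 T f /\ forall t, t \in `[0, T] -> F t = F 0 + \int[mu]_(s in `[0, t]) f s.

Lemma primitive_increment T F f a b : primitive T F f -> 0 <= a -> a <= b -> b <= T ->
  F b - F a = \int[mu]_(t in `[a, b]) f t.
Proof.
move=> [fi Ff] a0 ab bT.
rewrite (Ff a) ?(Ff b) ?in_itv/= ?a0 ?bT ?(le_trans a0 ab) ?(le_trans ab bT)//.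
by rewrite -(Rintegral_cc_split fi a0 ab bT); ring.
Qed.

Lemma within_continuous_eq a b f g : {in `[a, b], f =1 g} ->
  {within `[a, b], continuous f} -> {within `[a, b], continuous g}.
Proof.
move=> fg; apply: (@subspace_eq_continuous _ `[a, b]%classic _ f g).
by move=> t; rewrite inE/= => tab; apply: fg.
Qed.

Lemma within_continuousD a b f g : {within `[a, b], continuous f} ->
  {within `[a, b], continuous g} ->
  {within `[a, b], continuous (fun t => f t + g t)}.
Proof. by move=> cf cg t; apply: cvgD; [exact: cf|exact: cg]. Qed.

Lemma within_continuousM a b f g : {within `[a, b], continuous f} ->
  {within `[a, b], continuous g} ->
  {within `[a, b], continuous (fun t => f t * g t)}.
Proof. by move=> cf cg t; apply: cvgM; [exact: cf|exact: cg]. Qed.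

Lemma within_continuousB a b f g : {within `[a, b], continuous f} ->
  {within `[a, b], continuous g} ->
  {within `[a, b], continuous (fun t => f t - g t)}.
Proof. by move=> cf cg t; apply: cvgB; [exact: cf|exact: cg]. Qed.

Lemma primitive_continuous T F f : 0 <= T -> primitive T F f ->
  {within `[0, T], continuous F}.
Proof.
move=> T0 [fi Ff].
apply: (@within_continuous_eq _ _ (fun t => F 0 + \int[mu]_(s in `[0, t]) f s)).
  by move=> t tT; rewrite -Ff.
apply: within_continuousD; last exact: parameterized_integral_continuous.
by apply: continuous_subspaceT => t; exact: cvg_cst.
Qed.

(* Splitting the range of the continuous function Phi, rather than its domain,
   into n equal pieces gives |H b - H a| <= n (L / n)^2. *)
Lemma eq_of_le_sqr a b H Phi : a <= b ->
  {within `[a, b], continuous Phi} ->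
  (forall s t, a <= s -> s <= t -> t <= b -> Phi s <= Phi t) ->
  (forall s t, a <= s -> s <= t -> t <= b ->
    `|H t - H s| <= (Phi t - Phi s) ^+ 2) ->
  H b = H a.
Proof.
move=> ab cP mP HP; pose L := Phi b - Phi a.
have L0 : 0 <= L by rewrite subr_ge0 mP.
have step n i t : a <= t -> t <= b -> Phi t <= Phi a + i%:R * (L / n.+1%:R) ->
    `|H t - H a| <= i%:R * (L / n.+1%:R) ^+ 2.
  set d := L / n.+1%:R; have d0 : 0 <= d by rewrite divr_ge0.
  elim: i t => [|i IH] t at_ tb Pt.
    rewrite mul0r; apply: le_trans (HP _ _ _ _ _) _ => //.
    suff -> : Phi t = Phi a by rewrite subrr expr0n.
    by apply: le_anti; rewrite (mP a t)// andbT; move: Pt; rewrite mul0r addr0.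
  have [/(IH _ at_ tb)|Pt'] := leP (Phi t) (Phi a + i%:R * d).
    move=> /le_trans; apply; rewrite ler_wpM2r ?sqr_ge0// ler_nat//.
  have id0 : 0 <= i%:R * d by rewrite mulr_ge0.
  have cPt : {within `[a, t], continuous Phi}.
    by apply: continuous_subspaceW cP; apply: subset_itvl; rewrite bnd_simp.
  (* At [s] the function Phi attains the i-th level: the induction hypothesis covers [a, s], and Phi
     grows by at most d on [s, t]. *)
  have [|s] := @IVT _ Phi a t (Phi a + i%:R * d) at_ cPt.
    have Pat : Phi a <= Phi t by exact: mP.
    by rewrite (min_idPl Pat) (max_idPr Pat) lerDl id0 ltW.
  rewrite in_itv/= => /andP[as_ st] Ps.
  have -> : H t - H a = (H t - H s) + (H s - H a) by ring.
  rewrite -natr1 mulrDl mul1r [leRHS]addrC (le_trans (ler_normD _ _))// lerD//.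
    apply: le_trans (HP _ _ _ _ _) _ => //; rewrite ler_sqr ?nnegrE ?subr_ge0//.
    - rewrite Ps; move: Pt; rewrite -natr1 mulrDl mul1r; lra.
    - by rewrite mP.
  by apply: IH => //; [exact: le_trans tb|rewrite Ps].
have bnd n : `|H b - H a| <= L ^+ 2 / n.+1%:R.
  have n0 : n.+1%:R != 0 :> K by rewrite pnatr_eq0.
  have := step n n.+1 b ab (lexx b).
  have -> : n.+1%:R * (L / n.+1%:R) = L by rewrite mulrC divfK.
  move=> /(_ _); rewrite subrKC lexx => /(_ isT) /le_trans; apply.
  by rewrite expr2 mulrA [n.+1%:R * _]mulrC divfK// mulrA -expr2.
apply/eqP; rewrite -subr_eq0 -normr_le0; apply/ler_addgt0Pl => e e0.
rewrite addr0; have L1 : 0 < e / (L ^+ 2 + 1).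
  by rewrite divr_gt0// ltr_pwDr// sqr_ge0.
have [n _ /(_ n (leqnn n)) /= Hn] := near_natSinv_lt L1.
apply: le_trans (bnd n) _.
apply: le_trans (_ : (L ^+ 2 + 1) * n.+1%:R^-1 <= _).
  by rewrite ler_wpM2r// ?invr_ge0// lerDl.
by rewrite mulrC -ler_pdivlMr ?ltW// ltr_pwDr// sqr_ge0.
Qed.

Lemma le_norm_Rintegral a b f : a <= b -> intg a b f ->
  `|\int[mu]_(t in `[a, b]) f t| <= \int[mu]_(t in `[a, b]) `|f t|.
Proof. by move=> ab fi; apply: le_normr_Rintegral. Qed.

Lemma intg_norm a b f : intg a b f -> intg a b (fun t => `|f t|).
Proof. exact: integrable_norm. Qed.

Lemma primitive_norm_le T F f a s b : primitive T F f -> 0 <= a -> a <= s ->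
  s <= b -> b <= T ->
  `|F b - F s| <= \int[mu]_(t in `[a, b]) `|f t| /\
  `|F a - F s| <= \int[mu]_(t in `[a, b]) `|f t|.
Proof.
move=> pF a0 as_ sb bT; have [fi _] := pF.
have ni := intg_norm fi.
have nn c d : 0 <= \int[mu]_(t in `[c, d]) `|f t| by apply: Rintegral_ge0.
have s0 := le_trans a0 as_; have sT := le_trans sb bT.
have spl : \int[mu]_(t in `[a, b]) `|f t| =
    \int[mu]_(t in `[a, s]) `|f t| + \int[mu]_(t in `[s, b]) `|f t|.
  rewrite -(Rintegral_cc_split ni a0 (le_trans as_ sb) bT).
  rewrite -(Rintegral_cc_split ni a0 as_ sT) -(Rintegral_cc_split ni s0 sb bT).
  by ring.
rewrite spl; split.
  rewrite (primitive_increment pF s0 sb bT); apply: le_trans (le_norm_Rintegral _ _) _ => //.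
    by apply: intgSl (intgS _ fi); rewrite ?s0//= (le_trans s0).
  by rewrite lerDr.
rewrite distrC (primitive_increment pF a0 as_ sT).
apply: le_trans (le_norm_Rintegral _ _) _ => //.
  by apply: intgSl (intgS _ fi); rewrite ?a0//= (le_trans a0).
by rewrite lerDl.
Qed.

(** The defect H of the product rule has the increment over [a, b] equal to the integral of f (G b -
    G) + g (F a - F). With A and B the integrals of |f| and |g| over [a, b], this is at most 2 A B
    <= (A + B)^2 in absolute value, so [eq_of_le_sqr] applies with Phi the primitive of |f| +
    |g|. *)
Lemma primitiveM T F f G g : 0 <= T -> primitive T F f -> primitive T G g ->
  primitive T (fun t => F t * G t) (fun t => f t * G t + g t * F t).
Proof.
move=> T0 pF pG; have [fi _] := pF; have [gi _] := pG.
have cF := primitive_continuous T0 pF; have cG := primitive_continuous T0 pG.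
have hi : intg 0 T (fun t => f t * G t + g t * F t).
  by apply: intgD; apply: intgM_continuous.
split=> // t; rewrite in_itv/= => /andP[t0 tT].
pose h t := f t * G t + g t * F t.
pose H t := F t * G t - \int[mu]_(s in `[0, t]) h s.
pose phi t := `|f t| + `|g t|.
have phii : intg 0 T phi by apply: intgD; exact: intg_norm.
suff : H t = H 0.
  by rewrite /H Rintegral_itv1 subr0 => /eqP; rewrite subr_eq => /eqP.
apply: (@eq_of_le_sqr _ _ H (fun t => \int[mu]_(s in `[0, t]) phi s)) => //.
- by apply: parameterized_integral_continuous => //; apply: intgS phii; rewrite t0.
- move=> a b a0 ab bt; rewrite -subr_ge0.
  rewrite (Rintegral_cc_split phii a0 ab (le_trans bt tT)).
  by apply: Rintegral_ge0 => x _; rewrite addr_ge0.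
move=> a b a0 ab bt; have bT := le_trans bt tT.
have ii k : intg 0 T k -> intg a b k.
  by move=> ki; apply: intgSl (intgS _ ki); rewrite ?a0//= (le_trans a0).
rewrite (Rintegral_cc_split phii a0 ab bT) /phi RintegralD//; last 2 first.
- exact/ii/intg_norm.
- exact/ii/intg_norm.
set A := (X in (X + _) ^+ 2); set B := (X in (_ + X) ^+ 2).
have A0 : 0 <= A by apply: Rintegral_ge0.
have B0 : 0 <= B by apply: Rintegral_ge0.
have fG : intg 0 T (fun s => f s * G b).
  by apply: intg_eq (intgZ (G b) fi) => s _; rewrite mulrC.
have gF : intg 0 T (fun s => g s * F a).
  by apply: intg_eq (intgZ (F a) gi) => s _; rewrite mulrC.
have -> : H b - H a = \int[mu]_(s in `[a, b])
    (f s * (G b - G s) + g s * (F a - F s)).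
  have -> : H b - H a = (F b - F a) * G b + (G b - G a) * F a -
      \int[mu]_(s in `[a, b]) h s.
    by rewrite -(Rintegral_cc_split hi a0 ab bT) /H; ring.
  rewrite (primitive_increment pF a0 ab bT) (primitive_increment pG a0 ab bT).
  rewrite -!RintegralZr//; try exact: ii.
  rewrite -RintegralD//.
  + rewrite -RintegralB//.
    * by apply: eq_Rintegral => s _; rewrite /h; ring.
    * exact/ii/intgD.
    * exact: ii.
  + exact: ii.
  + exact: ii.
have ki : intg 0 T (fun s => f s * (G b - G s) + g s * (F a - F s)).
  by apply: intgD; apply: intgM_continuous => //; apply: within_continuousB => //;
    apply: continuous_subspaceT => x; exact: cvg_cst.
apply: le_trans (le_norm_Rintegral ab (ii _ ki)) _.
apply: le_trans (_ : \int[mu]_(s in `[a, b]) (B * `|f s| + A * `|g s|) <= _).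
  apply: le_Rintegral => //.
  - exact/ii/intg_norm.
  - by apply/ii/intgD; apply/intgZ/intg_norm.
  move=> s /=; rewrite in_itv/= => /andP[as_ sb].
  rewrite (le_trans (ler_normD _ _))// !normrM lerD// mulrC ler_wpM2r//.
    by have [] := primitive_norm_le pG a0 as_ sb bT.
  by have [] := primitive_norm_le pF a0 as_ sb bT.
rewrite RintegralD//; last 2 first.
- exact/ii/intgZ/intg_norm.
- exact/ii/intgZ/intg_norm.
rewrite !RintegralZl//; last 2 first.
- exact/ii/intg_norm.
- exact/ii/intg_norm.
rewrite -/A -/B; nra.
Qed.

Lemma primitiveD T F f G g : primitive T F f -> primitive T G g ->
  primitive T (fun t => F t + G t) (fun t => f t + g t).
Proof.
move=> [fi Ff] [gi Gg]; split; first exact: intgD.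
move=> t tT; move: (tT); rewrite in_itv/= => tT'.
rewrite Ff// Gg// RintegralD//; first by rewrite addrACA.
- exact: intgS fi.
- exact: intgS gi.
Qed.

Lemma primitiveZ T k F f : primitive T F f ->
  primitive T (fun t => k * F t) (fun t => k * f t).
Proof.
move=> [fi Ff]; split; first exact: intgZ.
move=> t tT; move: (tT); rewrite in_itv/= => tT'.
by rewrite Ff// RintegralZl ?mulrDr//; exact: intgS fi.
Qed.

Lemma primitive_sum T I (r : seq I) (F f : I -> K -> K) :
  (forall i, primitive T (F i) (f i)) ->
  primitive T (fun t => \sum_(i <- r) F i t) (fun t => \sum_(i <- r) f i t).
Proof.
move=> Ff; elim: r => [|i r IH].
  have -> : (fun t => \sum_(i <- [::]) F i t) = cst 0.
    by apply/funext => t; rewrite big_nil.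
  have -> : (fun t => \sum_(i <- [::]) f i t) = cst 0.
    by apply/funext => t; rewrite big_nil.
  split; first exact: intg0.
  by move=> t _; rewrite Rintegral_cst// mul0r addr0.
have -> : (fun t => \sum_(i <- i :: r) F i t) =
    (fun t => F i t + \sum_(i <- r) F i t).
  by apply/funext => t; rewrite big_cons.
have -> : (fun t => \sum_(i <- i :: r) f i t) =
    (fun t => f i t + \sum_(i <- r) f i t).
  by apply/funext => t; rewrite big_cons.
exact: primitiveD.
Qed.

Lemma primitive_expR T c : primitive T (fun t => expR (c * t))
  (fun t => c * expR (c * t)).
Proof.
have ce : continuous (fun t => expR (c * t)).
  by move=> t; apply: continuous_comp; [exact: mulrl_continuous|exact: continuous_expR].
have cce : continuous (fun t => c * expR (c * t)).
  by move=> t; apply: cvgM; [exact: cvg_cst|exact: ce].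
split; first exact/intg_continuous/continuous_subspaceT.
move=> t; rewrite in_itv/= => /andP[+ _].
rewrite le_eqVlt => /predU1P[<-|t0]; first by rewrite Rintegral_itv1 addr0.
have de s : is_derive s 1 (fun t => expR (c * t)) (c * expR (c * s)).
  have hc : is_derive s 1 (fun t => c * t) c.
    have -> : (fun t => c * t) = c \*: id :> (K -> K) by apply/funext.
    by apply: is_derive_eq; rewrite /GRing.scale /= mulr1.
  have := @is_derive1_comp _ expR (fun t => c * t) s _ _ (is_derive_expR _) hc.
  by move=> H; apply: is_derive_eq H _; rewrite mulrC.
rewrite /Rintegral (@continuous_FTC2 _ _ (fun t => expR (c * t))) //=.
- by ring.
- exact: continuous_subspaceT.
- split; first by move=> s _; have [] := de s.
  + exact/cvg_at_right_filter/ce.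
  + exact/cvg_at_left_filter/ce.
- by move=> s _; have H := de s; rewrite derive1E derive_val.
Qed.

(** At a Lebesgue point inside (0, T) the indefinite integral has derivative h t, while it vanishes
    identically nearby. *)
Lemma ae_eq0_of_primitive T h : 0 < T -> intg 0 T h ->
  (forall t, t \in `[0, T] -> \int[mu]_(s in `[0, t]) h s = 0) ->
  {ae mu, forall t, t \in `[0, T] -> h t = 0}.
Proof.
move=> T0 hi h0; set k := h \_ `[0, T].
have lh : {ae mu, forall t, lebesgue_pt k t}.
  exact/lebesgue_differentiation/integrable_locally.
apply: ae_imp2 lh (ae_imp2 (ae_neq 0) (ae_neq T) (fun t => @conj _ _)) _.
move=> t Lt [t0 tT]; rewrite in_itv/= !le_eqVlt eq_sym (negbTE t0) (negbTE tT)/=.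
move=> /andP[{}t0 {}tT].
have kE s : s \in `[0, T] -> k s = h s.
  by move=> sT; rewrite /k patchE mem_set.
have ki : intg 0 T k by apply: intg_eq hi => s /kE.
have [_] := @FTC1_lebesgue_pt _ k (BLeft 0) t T tT ki t0 Lt.
rewrite kE ?in_itv/= ?ltW// => <-.
apply: (@derive1_near_cst _ _ 0); near=> s.
have s0 : 0 < s by near: s; exact: lt_nbhsr.
have sT : s < T by near: s; exact: lt_nbhsl.
rewrite -[RHS](h0 s) ?in_itv/= ?ltW//; apply: eq_Rintegral => r.
rewrite inE/= in_itv/= => /andP[r0 rs].
by apply: kE; rewrite in_itv/= r0 (le_trans rs)// ltW.
Unshelve. all: by end_near. Qed.

Lemma within_continuous_ae_eq0 T h : 0 < T -> {within `[0, T], continuous h} ->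
  {ae mu, forall t, t \in `[0, T] -> h t = 0} ->
  forall t, t \in `[0, T] -> h t = 0.
Proof.
move=> T0 ch h0 t tT; apply/eqP; apply: contraT => ht.
have := (subspace_continuousP _ _).1 ch t tT.
have hn : 0 < `|h t| by rewrite normr_gt0.
move=> /cvgrPdist_lt /(_ _ hn) [d /= d0 hd].
move: (tT); rewrite in_itv/= => /andP[t0 tT'].
(* Clipping (t - d, t + d) to (0, T) leaves an interval of positive length even if t is an endpoint,
   so it contains a zero of h. *)
have [|s [/andP[s1 s2] hs]] :=
  @ae_exists _ (Num.max 0 (t - d)) (Num.min T (t + d)) _ _ h0.
  by rewrite lt_min !gt_max; apply/andP; split; lra.
move: s1 s2; rewrite gt_max lt_min => /andP[s0 sd] /andP[sT sd'].
have sT' : s \in `[0, T] by rewrite in_itv/= !ltW.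
have st : ball_ Num.norm t d s by rewrite /= ltr_distl; apply/andP; split; lra.
have := hd s st sT'; rewrite /from_subspace (hs sT') subr0.
by rewrite ltxx.
Qed.

End Primitives.

(** * Vector-valued functions and quadratic forms *)

Section VectorValued.
Context {K : realType}.
Local Notation mu := (@lebesgue_measure K).
Implicit Types (a b c s t T : K) (n : nat).

Definition dot n (u v : 'cV[K]_n) : K := (u^T *m v) ord0 ord0.

Lemma dotE n (u v : 'cV[K]_n) : dot u v = \sum_i u i ord0 * v i ord0.
Proof. by rewrite /dot mxE; apply: eq_bigr => i _; rewrite mxE. Qed.

Lemma dotC n (u v : 'cV[K]_n) : dot u v = dot v u.
Proof. by rewrite !dotE; apply: eq_bigr => i _; rewrite mulrC. Qed.

Lemma dotDl n (u v w : 'cV[K]_n) : dot (u + v) w = dot u w + dot v w.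
Proof. by rewrite /dot linearD mulmxDl mxE. Qed.

Lemma dotDr n (u v w : 'cV[K]_n) : dot u (v + w) = dot u v + dot u w.
Proof. by rewrite /dot mulmxDr mxE. Qed.

Lemma dotZl n k (u v : 'cV[K]_n) : dot (k *: u) v = k * dot u v.
Proof. by rewrite /dot linearZ -scalemxAl mxE. Qed.

Lemma dotZr n k (u v : 'cV[K]_n) : dot u (k *: v) = k * dot u v.
Proof. by rewrite /dot -scalemxAr mxE. Qed.

Lemma dotNl n (u v : 'cV[K]_n) : dot (- u) v = - dot u v.
Proof. by rewrite -scaleN1r dotZl mulN1r. Qed.

Lemma dotNr n (u v : 'cV[K]_n) : dot u (- v) = - dot u v.
Proof. by rewrite dotC dotNl dotC. Qed.

Lemma dot_mulmx m n (A : 'M[K]_(m, n)) u v : dot (A *m u) v = dot u (A^T *m v).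
Proof. by rewrite /dot trmx_mul mulmxA. Qed.

Lemma enorm_sqr n (v : 'cV[K]_n) : enorm v ^+ 2 = dot v v.
Proof.
rewrite sqr_sqrtr; first by rewrite dotE; apply: eq_bigr => i _; rewrite expr2.
by apply: sumr_ge0 => i _; rewrite sqr_ge0.
Qed.

Lemma enorm_ge0 n (v : 'cV[K]_n) : 0 <= enorm v.
Proof. exact: sqrtr_ge0. Qed.

Lemma dot_ge0 n (v : 'cV[K]_n) : 0 <= dot v v.
Proof. by rewrite -enorm_sqr sqr_ge0. Qed.

Lemma sqr_coord_le n (v : 'cV[K]_n) i : v i ord0 ^+ 2 <= dot v v.
Proof.
rewrite dotE (bigD1 i)//= -expr2 lerDl sumr_ge0// => j _.
by rewrite -expr2 sqr_ge0.
Qed.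

Lemma psdmxP n (A : 'M[K]_n) : psdmx A <-> A^T = A /\ forall v, 0 <= dot v (A *m v).
Proof.
by split=> -[At A0]; split => // v; have := A0 v; rewrite /dot mulmxA.
Qed.

(** The polynomial a + 2 s b + s^2 c, the form at u + s v, is nonnegative. For c > 0 its minimiser s
    = - b/c gives the claim; for c = 0 and b nonzero, s = - (a + 1) / (2 b) would give the value
    -1. *)
Lemma psdmx_cauchy n (A : 'M[K]_n) (u v : 'cV[K]_n) : psdmx A ->
  dot u (A *m v) ^+ 2 <= dot u (A *m u) * dot v (A *m v).
Proof.
move=> /psdmxP[At A0]; set b := dot u (A *m v).
set a := dot u (A *m u); set c := dot v (A *m v).
have q s : 0 <= a + 2 * s * b + s ^+ 2 * c.
  have := A0 (u + s *: v).
  rewrite mulmxDr !dotDl !dotDr -!scalemxAr !dotZl !dotZr -/a -/b -/c.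
  have -> : dot v (A *m u) = b by rewrite dotC dot_mulmx At.
  by congr (0 <= _); ring.
have a0 : 0 <= a by exact: A0.
have : 0 <= c by exact: A0.
rewrite le_eqVlt => /predU1P[c0|c0].
  rewrite -c0 mulr0; have [->|b0] := eqVneq b 0; first by rewrite expr0n.
  have := q (- (a + 1) / (2 * b)); rewrite -c0 mulr0 addr0.
  have -> : 2 * (- (a + 1) / (2 * b)) * b = - (a + 1) by field.
  by move=> H; exfalso; move: H; apply/negP; rewrite -ltNge; lra.
have := q (- (b / c)).
have -> : a + 2 * - (b / c) * b + (- (b / c)) ^+ 2 * c = (a * c - b ^+ 2) / c.
  by field; rewrite gt_eqF.
by rewrite pmulr_lge0 ?invr_gt0// subr_ge0.
Qed.

Lemma psdmx_sqr_coord n (A : 'M[K]_n) (v : 'cV[K]_n) i : psdmx A ->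
  (A *m v) i ord0 ^+ 2 <= A i i * dot v (A *m v).
Proof.
move=> pA; have := psdmx_cauchy (delta_mx i ord0) v pA.
have dl w : dot (delta_mx i ord0) w = w i ord0 :> K.
  by rewrite /dot trmx_delta -rowE mxE.
by rewrite !dl -(colE i A) [X in _ <= X * _]mxE.
Qed.

(** Cauchy-Schwarz for the form of A against each unit vector, summed over the coordinates. This is
    how the energies of S and R bound vectors. *)
Lemma psdmx_dot_le n (A : 'M[K]_n) (v : 'cV[K]_n) : psdmx A ->
  dot (A *m v) (A *m v) <= \tr A * dot v (A *m v).
Proof.
move=> pA; rewrite dotE /mxtrace mulr_suml ler_sum// => i _.
by rewrite -expr2 psdmx_sqr_coord.
Qed.

Lemma psdmx_tr_ge0 n (A : 'M[K]_n) : psdmx A -> 0 <= \tr A.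
Proof.
move=> pA; rewrite /mxtrace sumr_ge0// => i _.
have [_ /(_ (delta_mx i ord0))] := pA.
by rewrite trmx_delta -rowE -colE !mxE.
Qed.

Lemma skew_dot n (A : 'M[K]_n) (v : 'cV[K]_n) : A^T = - A -> dot v (A *m v) = 0.
Proof.
move=> At; have := dot_mulmx A v v; rewrite At mulNmx dotNr dotC => H.
lra.
Qed.

Lemma psdmx_congr m n (A : 'M[K]_n) (X : 'M[K]_(n, m)) : psdmx A ->
  psdmx (X^T *m A *m X).
Proof.
move=> /psdmxP[At A0]; apply/psdmxP; split.
  by rewrite !trmx_mul trmxK At mulmxA.
by move=> v; rewrite -!mulmxA dotC dot_mulmx trmxK dotC A0.
Qed.

Lemma dot_addZ n (u v : 'cV[K]_n) k : dot (u + k *: v) (u + k *: v) =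
  dot u u + 2 * k * dot u v + k ^+ 2 * dot v v.
Proof. by rewrite !dotDl !dotDr !dotZl !dotZr [dot v u]dotC; ring. Qed.

Lemma dot_subZ n (u v : 'cV[K]_n) k : dot (u - k *: v) (u - k *: v) =
  dot u u - 2 * k * dot u v + k ^+ 2 * dot v v.
Proof. by rewrite -scaleNr dot_addZ; ring. Qed.

(* With A P A = A, the matrix G = P^T A P is a symmetric reflexive
   generalized inverse of A: it recovers v^T A v from A v. *)
Lemma psdmx_ginv n (A : 'M[K]_n) : psdmx A ->
  exists2 G : 'M[K]_n, psdmx G & A *m G *m A = A.
Proof.
move=> pA; have [At _] := pA.
have [P APA] : exists P, A *m P *m A = A by exists (pinvmx A); apply: mulmxKpV.
exists (P^T *m A *m P); first exact: psdmx_congr.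
have APA' : A *m P^T *m A = A.
  by have := congr1 trmx APA; rewrite !trmx_mul At mulmxA.
by rewrite !mulmxA APA' APA.
Qed.

Lemma enorm0 n : enorm (0 : 'cV[K]_n) = 0.
Proof. by rewrite /enorm big1 ?sqrtr0// => i _; rewrite mxE expr0n. Qed.

Lemma enormZ n (v : 'cV[K]_n) k : 0 <= k -> enorm (k *: v) = k * enorm v.
Proof.
move=> k0; rewrite /enorm.
have -> : \sum_i (k *: v) i ord0 ^+ 2 = k ^+ 2 * \sum_i v i ord0 ^+ 2.
  by rewrite mulr_sumr; apply: eq_bigr => i _; rewrite mxE exprMn.
by rewrite sqrtrM ?sqr_ge0// sqrtr_sqr ger0_norm.
Qed.

Lemma enorm_eq0 n (v : 'cV[K]_n) : enorm v = 0 -> v = 0.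
Proof.
move=> v0; apply/colP => i; rewrite mxE; apply/eqP; rewrite -sqrf_eq0.
rewrite eq_le sqr_ge0 andbT; apply: le_trans (sqr_coord_le v i) _.
by rewrite -enorm_sqr v0 expr0n.
Qed.

Lemma opnorm_ub n p (A : 'M[K]_(p, n)) (v : 'cV[K]_n) : enorm v <= 1 ->
  enorm (A *m v) <= opnorm A.
Proof.
move=> v1; apply: ub_le_sup; last by exists v.
have coord1 (w : 'cV[K]_n) i : enorm w <= 1 -> `|w i ord0| <= 1.
  move=> w1; rewrite -(ler_sqr (x := `|w i ord0|)) ?nnegrE// expr1n real_normK ?num_real//.
  apply: le_trans (sqr_coord_le w i) _; rewrite -enorm_sqr.
  by rewrite -(expr1n _ 2) ler_sqr ?nnegrE ?enorm_ge0.
(* The supremum needs some upper bound; on the unit ball every coordinate is at most 1 in absolute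
   value, so absolute row sums suffice. *)
exists (Num.sqrt (\sum_i (\sum_j `|A i j|) ^+ 2)) => _ [w w1 <-].
apply: ler_wsqrtr; apply: ler_sum => i _.
rewrite -(real_normK (num_real ((A *m w) i ord0))).
rewrite ler_sqr ?nnegrE ?sumr_ge0// mxE.
apply: le_trans (ler_norm_sum _ _ _) _; apply: ler_sum => j _.
by rewrite normrM ler_piMr// coord1.
Qed.

Lemma opnorm_ge0 n p (A : 'M[K]_(p, n)) : 0 <= opnorm A.
Proof.
apply: le_trans (enorm_ge0 (A *m (0 : 'cV[K]_n))) _.
by apply: opnorm_ub; rewrite enorm0.
Qed.

Lemma opnorm_le n p (A : 'M[K]_(p, n)) (v : 'cV[K]_n) :
  enorm (A *m v) <= opnorm A * enorm v.
Proof.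
have [/enorm_eq0->|v0] := eqVneq (enorm v) 0.
  by rewrite mulmx0 !enorm0 mulr0.
have vp : 0 < enorm v by rewrite lt_neqAle eq_sym v0 enorm_ge0.
rewrite -ler_pdivrMr// mulrC -enormZ ?invr_ge0 ?enorm_ge0// scalemxAr.
by apply: opnorm_ub; rewrite enormZ ?invr_ge0 ?enorm_ge0// mulVf.
Qed.

(** Measurability of f is kept apart, as it does not follow from that of its square. *)
Definition sqintg T (f : K -> K) :=
  measurable_fun `[0, T] f /\ intg 0 T (fun t => f t ^+ 2).

Lemma sqintgM T f g : sqintg T f -> sqintg T g -> intg 0 T (fun t => f t * g t).
Proof.
move=> [mf f2] [mg g2]; apply: intg_le (intgD f2 g2) _ _.
  exact: measurable_funM.
move=> t _; rewrite normrM -(real_normK (num_real (f t))).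
rewrite -(real_normK (num_real (g t))).
have := normr_ge0 (f t); have := normr_ge0 (g t); nra.
Qed.

Lemma sqintg_cst T c : sqintg T (fun=> c).
Proof.
split=> //; apply: intg_continuous; apply: continuous_subspaceT => t.
exact: cvg_cst.
Qed.

Lemma sqintg_intg T f : sqintg T f -> intg 0 T f.
Proof.
move=> /sqintgM /(_ (sqintg_cst T 1)); apply: intg_eq => t _.
by rewrite mulr1.
Qed.

Lemma sqintgD T f g : sqintg T f -> sqintg T g -> sqintg T (fun t => f t + g t).
Proof.
move=> sf sg; have [mf f2] := sf; have [mg g2] := sg.
split; first exact: measurable_funD.
apply: intg_eq (intgD (intgD f2 (intgZ 2 (sqintgM sf sg))) g2) => t _ /=.
by ring.
Qed.

Lemma sqintgM_continuous T f h : 0 <= T -> sqintg T f ->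
  {within `[0, T], continuous h} -> sqintg T (fun t => f t * h t).
Proof.
move=> T0 [mf f2] ch; split.
  by apply: measurable_funM => //; exact: within_continuous_measurable.
have := intgM_continuous T0 f2 (within_continuousM ch ch).
by apply: intg_eq => t _; rewrite exprMn [(h t : K) ^+ 2]expr2.
Qed.

Lemma sqintgZ T k f : sqintg T f -> sqintg T (fun t => k * f t).
Proof.
move=> [mf f2]; split; first exact: measurable_funM.
by apply: intg_eq (intgZ (k ^+ 2) f2) => t _; rewrite exprMn.
Qed.

Lemma sqintg_sum T I (r : seq I) (f : I -> K -> K) :
  (forall i, sqintg T (f i)) -> sqintg T (fun t => \sum_(i <- r) f i t).
Proof.
move=> sf; elim: r => [|i r IH].
  have -> : (fun t => \sum_(i <- [::]) f i t) = (fun=> 0).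
    by apply/funext => t; rewrite big_nil.
  exact: sqintg_cst.
have -> : (fun t => \sum_(i <- i :: r) f i t) =
    (fun t => f i t + \sum_(i <- r) f i t).
  by apply/funext => t; rewrite big_cons.
exact: sqintgD.
Qed.

Lemma L2P T n (f : K -> 'cV[K]_n) :
  L2 T f <-> forall i, sqintg T (fun t => f t i ord0).
Proof.
split=> [[mf fi] i|sf].
  have m2 : measurable_fun `[0, T] (fun t => enorm (f t) ^+ 2).
    have -> : (fun t => enorm (f t) ^+ 2) = (fun t => \sum_i f t i ord0 ^+ 2).
      by apply/funext => t; rewrite enorm_sqr dotE; apply: eq_bigr => j _.
    by apply: measurable_sum => j; exact: measurable_funX.
  have i2 : intg 0 T (fun t => enorm (f t) ^+ 2).
    apply/integrableP; split; first exact/measurable_EFinP.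
    apply: le_lt_trans fi; rewrite le_eqVlt; apply/orP; left; apply/eqP.
    by apply: eq_integral => t _ /=; rewrite ger0_norm ?sqr_ge0.
  split; first exact: mf.
  apply: intg_le i2 _ _; first exact: measurable_funX.
  by move=> t _; rewrite ger0_norm ?sqr_ge0// enorm_sqr sqr_coord_le.
split; first by move=> i; have [] := sf i.
have : intg 0 T (fun t => \sum_i f t i ord0 ^+ 2).
  by apply: intg_sum => i; have [] := sf i.
move=> /integrableP[_]; apply: le_lt_trans; rewrite le_eqVlt; apply/orP; left.
apply/eqP; apply: eq_integral => t _ /=.
rewrite ger0_norm; last by apply: sumr_ge0 => i _; rewrite sqr_ge0.
by rewrite enorm_sqr dotE; congr EFin; apply: eq_bigr => j _.
Qed.

Lemma L2D T n (f g : K -> 'cV[K]_n) : L2 T f -> L2 T g ->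
  L2 T (fun t => f t + g t).
Proof.
move=> /L2P sf /L2P sg; apply/L2P => i.
have -> : (fun t => (f t + g t) i ord0) = (fun t => f t i ord0 + g t i ord0).
  by apply/funext => t; rewrite mxE.
exact: sqintgD.
Qed.

Lemma L2_mulmx T m n (A : 'M[K]_(m, n)) (f : K -> 'cV[K]_n) : L2 T f ->
  L2 T (fun t => A *m f t).
Proof.
move=> /L2P sf; apply/L2P => i.
have -> : (fun t => (A *m f t) i ord0) = (fun t => \sum_j A i j * f t j ord0).
  by apply/funext => t; rewrite mxE.
by apply: sqintg_sum => j; exact: sqintgZ.
Qed.

Lemma L2Z T n k (f : K -> 'cV[K]_n) : L2 T f -> L2 T (fun t => k *: f t).
Proof.
move=> /(L2_mulmx k%:M).
by under eq_fun do rewrite mul_scalar_mx.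
Qed.

Lemma L2B T n (f g : K -> 'cV[K]_n) : L2 T f -> L2 T g ->
  L2 T (fun t => f t - g t).
Proof.
move=> fi /(L2Z (-1)); under eq_fun do rewrite scaleN1r.
exact: L2D.
Qed.

Lemma L2_scale_expR T n c (f : K -> 'cV[K]_n) : 0 <= T -> L2 T f ->
  L2 T (fun t => expR (c * t) *: f t).
Proof.
move=> T0 /L2P sf; apply/L2P => i.
have -> : (fun t => (expR (c * t) *: f t) i ord0) =
    (fun t => f t i ord0 * expR (c * t)).
  by apply/funext => t; rewrite mxE mulrC.
apply: sqintgM_continuous => //.
exact: primitive_continuous T0 (primitive_expR T c).
Qed.

Lemma L2wE T omega n (f : K -> 'cV[K]_n) : 0 <= T -> L2w T omega f <-> L2 T f.
Proof.
move=> T0; split=> [|fi]; last exact: L2_scale_expR.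
move=> /(L2_scale_expR omega T0).
under eq_fun do rewrite scalerA -expRD mulNr subrr expR0 scale1r.
by [].
Qed.

Lemma intg_dot T n (f g : K -> 'cV[K]_n) : L2 T f -> L2 T g ->
  intg 0 T (fun t => dot (f t) (g t)).
Proof.
move=> /L2P sf /L2P sg.
have -> : (fun t => dot (f t) (g t)) =
    (fun t => \sum_i f t i ord0 * g t i ord0).
  by apply/funext => t; rewrite dotE.
by apply: intg_sum => i; exact: sqintgM.
Qed.

Lemma ae_forall (I : finType) (P : I -> K -> Prop) :
  (forall i, {ae mu, forall t, P i t}) -> {ae mu, forall t, forall i, P i t}.
Proof.
move=> aP; suff : {ae mu, forall t, forall i, i \in enum I -> P i t}.
  by move=> H; apply: ae_imp H _ => t H i; apply: H; rewrite mem_enum.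
elim: (enum I) => [|i r IH].
  by apply: ae_imp (ae_neq 0) _ => t _ i; rewrite in_nil.
apply: ae_imp2 (aP i) IH _ => t Pi Pr j; rewrite inE => /predU1P[->//|].
exact: Pr.
Qed.

Lemma cvg_col (T : Type) (F : set_system T) n (f : T -> 'cV[K]_n)
  (l : 'cV[K]_n) : Filter F ->
  (forall i, f t i ord0 @[t --> F] --> l i ord0) -> f t @[t --> F] --> l.
Proof.
move=> FF fl; apply/cvgrPdist_le => e e0.
have : \forall t \near F, forall i, `|l i ord0 - f t i ord0| <= e.
  apply: filter_forall => i; exact: (cvgrPdist_le _ _).1 (fl i) _ e0.
apply: filterS => t H; rewrite -[leLHS]/(mx_norm (l - f t)) mx_normrE; apply: bigmax_le => [|[i j] _ /=].
  exact: ltW.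
by rewrite ord1 !mxE.
Qed.

(** Neither [wderiv] nor [crep] may fall back on its default: the first has a witness by definition
    of [H1], the second gets one from [du_bois_reymond] in each coordinate. Continuous functions
    that agree almost everywhere agree on [0, T], so [crep] is that primitive. *)
Lemma H1_crep T n (f : K -> 'cV[K]_n) : 0 < T -> H1 T f ->
  [/\ L2 T (wderiv T f), aeq T (crep T f) f &
      forall i, primitive T (fun t => crep T f t i ord0)
                            (fun t => wderiv T f t i ord0)].
Proof.
move=> T0 [fL [g0 [g0L g0w]]].
have [gL gw] : L2 T (wderiv T f) /\ is_weak_deriv T f (wderiv T f).
  by apply: (@xgetPex _ (cst 0) [set g | L2 T g /\ is_weak_deriv T f g]); exists g0.
set g := wderiv T f in gL gw *.
have gi i : intg 0 T (fun t => g t i ord0) by exact/sqintg_intg/(L2P _ _).1.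
have fi i : intg 0 T (fun t => f t i ord0) by exact/sqintg_intg/(L2P _ _).1.
have /choice[c hc] : forall i, exists c, {ae mu, forall t, t \in `[0, T] ->
    f t i ord0 = c + \int[mu]_(s in `[0, t]) g s i ord0}.
  move=> i; apply: du_bois_reymond => // phi tphi.
  exact: gw.
pose P i t := c i + \int[mu]_(s in `[0, t]) g s i ord0.
have pP i : primitive T (P i) (fun t => g t i ord0).
  by split=> // t _; rewrite /P Rintegral_itv1 addr0.
have cP i : {within `[0, T], continuous (P i)}.
  exact: primitive_continuous (ltW T0) (pP i).
have [cF aF] : {within `[0, T], continuous (crep T f)} /\ aeq T (crep T f) f.
  apply: (@xgetPex _ f [set F : K -> 'cV[K]_n |
    {within `[0, T], continuous F} /\ aeq T F f]).
  exists (fun t => \col_i P i t); split.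
    move=> t; apply: cvg_col => i.
    have -> : (fun s => (\col_i P i s) i ord0) = P i.
      by apply/funext => s; rewrite mxE.
    by rewrite /from_subspace mxE; exact: cP.
  apply: ae_imp (ae_forall hc) _ => t H tT; apply/colP => i.
  by rewrite mxE H.
split=> // i; have cFi : {within `[0, T], continuous (fun t => crep T f t i ord0)}.
  move=> t; apply: (@continuous_comp _ _ _ (crep T f : subspace _ -> _)
    (fun M : 'cV[K]_n => M i ord0)); [exact: cF|exact: coord_continuous].
have E t : t \in `[0, T] -> crep T f t i ord0 = P i t.
  move=> tT; apply/eqP; rewrite -subr_eq0; apply/eqP.
  apply: (within_continuous_ae_eq0 T0 (within_continuousB cFi (cP i))) tT.
  apply: ae_imp2 aF (hc i) _ => s H1s H2s sT.
  by rewrite -[LHS]/(crep T f s i ord0 - P i s) H1s// H2s// subrr.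
split; first exact: gi.
move=> t tT; rewrite (E t tT) (E 0) ?in_itv/= ?lexx ?ltW//.
by rewrite /P Rintegral_itv1 addr0.
Qed.

Lemma dot_mulmxE n (A : 'M[K]_n) (u v : 'cV[K]_n) :
  dot u (A *m v) = \sum_i \sum_j A i j * (u i ord0 * v j ord0).
Proof.
rewrite dotE; apply: eq_bigr => i _; rewrite mxE mulr_sumr.
by apply: eq_bigr => j _; rewrite mulrCA.
Qed.

Lemma primitive_mulmx T m n (A : 'M[K]_(m, n)) (F f : K -> 'cV[K]_n) :
  (forall i, primitive T (fun t => F t i ord0) (fun t => f t i ord0)) ->
  forall i, primitive T (fun t => (A *m F t) i ord0) (fun t => (A *m f t) i ord0).
Proof.
move=> Ff i.
have mE (h : K -> 'cV[K]_n) :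
    (fun t => (A *m h t) i ord0) = (fun t => \sum_j A i j * h t j ord0).
  by apply/funext => t; rewrite mxE.
by rewrite !mE; apply: primitive_sum => j; exact: primitiveZ.
Qed.

Lemma primitive_mulmx_eq0 T n (M : 'M[K]_n) (F f : K -> 'cV[K]_n) : 0 < T ->
  (forall i, primitive T (fun t => F t i ord0) (fun t => f t i ord0)) ->
  {ae mu, forall t, t \in `[0, T] -> M *m F t = 0} ->
  forall t, t \in `[0, T] -> M *m F t = 0.
Proof.
move=> T0 Ff MF t tT; apply/colP => i; rewrite [RHS]mxE.
have cM := primitive_continuous (ltW T0) (primitive_mulmx M Ff i).
apply: (within_continuous_ae_eq0 T0 cM) tT.
by apply: ae_imp MF _ => s H sT; rewrite H// mxE.
Qed.

(** A linear constraint on F passes to its derivative: M F vanishes everywhere by continuity, so the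
    indefinite integral of M f is 0. *)
Lemma weak_deriv_mulmx_eq0 T n (M : 'M[K]_n) (F f : K -> 'cV[K]_n) : 0 < T ->
  (forall i, primitive T (fun t => F t i ord0) (fun t => f t i ord0)) ->
  {ae mu, forall t, t \in `[0, T] -> M *m F t = 0} ->
  {ae mu, forall t, t \in `[0, T] -> M *m f t = 0}.
Proof.
move=> T0 Ff /(primitive_mulmx_eq0 T0 Ff) M0.
suff /ae_forall H : forall i,
    {ae mu, forall t, t \in `[0, T] -> (M *m f t) i ord0 = 0}.
  by apply: ae_imp H _ => t H tT; apply/colP => i; rewrite [RHS]mxE H.
move=> i; have [Mi MP] := primitive_mulmx M Ff i.
apply: ae_eq0_of_primitive => // t tT.
have := MP t tT; rewrite (M0 t tT) (M0 0) ?in_itv/= ?lexx ?ltW//.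
by rewrite !mxE add0r.
Qed.

(** The product rule is applied to e^(-2 omega t) F^T G F, which involves F alone; q enters only
    afterwards, under the integral, where F = S q and f = S G f hold almost everywhere. *)
Lemma energy_identity T omega n (S G : 'M[K]_n) (F f q : K -> 'cV[K]_n) :
  0 < T -> psdmx S -> psdmx G -> S *m G *m S = S ->
  (forall i, primitive T (fun t => F t i ord0) (fun t => f t i ord0)) ->
  L2 T f -> L2 T q -> F 0 = 0 -> aeq T F (fun t => S *m q t) ->
  forall t, t \in `[0, T] ->
    expR (- 2 * omega * t) * dot (F t) (G *m F t) =
    \int[mu]_(s in `[0, t]) (expR (- 2 * omega * s) *
       (2 * dot (q s) (f s) - 2 * omega * dot (q s) (S *m q s))).
Proof.
move=> T0 /psdmxP[St S0] /psdmxP[Gt G0] SGS Ff fL qL F0 FS t tT.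
pose w s := expR (- 2 * omega * s).
pose D s := dot (F s) (G *m F s).
pose D' s := \sum_i \sum_j G i j *
  (f s i ord0 * F s j ord0 + f s j ord0 * F s i ord0).
have pD : primitive T D D'.
  have -> : D = (fun s => \sum_i \sum_j G i j * (F s i ord0 * F s j ord0)).
    by apply/funext => s; rewrite /D dot_mulmxE.
  apply: primitive_sum => i; apply: primitive_sum => j; apply: primitiveZ.
  exact: primitiveM (ltW T0) (Ff i) (Ff j).
have pw := primitive_expR T (- 2 * omega).
have pwD := primitiveM (ltW T0) pw pD.
have D0 : D 0 = 0 by rewrite /D F0 mulmx0 /dot mulmx0 mxE.
have [wDi /(_ t tT)] := pwD; rewrite D0 mulr0 add0r -/(w t) -/(D t) => ->.
move: (tT); rewrite in_itv/= => tT'.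
(* 1 - S G annihilates the range of S, hence F, hence almost everywhere its derivative. *)
have imS : {ae mu, forall s, s \in `[0, T] -> S *m (G *m f s) = f s}.
  have H : {ae mu, forall s, s \in `[0, T] -> (1%:M - S *m G) *m F s = 0}.
    apply: ae_imp FS _ => s H sT.
    by rewrite H// mulmxA mulmxBl mul1mx SGS subrr mul0mx.
  apply: ae_imp (weak_deriv_mulmx_eq0 T0 Ff H) _ => s {}H sT; have := H sT.
  by rewrite mulmxBl mul1mx -mulmxA => /eqP; rewrite subr_eq0 => /eqP <-.
have cw : {within `[0, T], continuous w}.
  exact: primitive_continuous (ltW T0) pw.
have ki : intg 0 T (fun s => w s *
    (2 * dot (q s) (f s) - 2 * omega * dot (q s) (S *m q s))).
  have := intgM_continuous (ltW T0) (intgB (intgZ 2 (intg_dot qL fL))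
    (intgZ (2 * omega) (intg_dot qL (L2_mulmx S qL)))) cw.
  by apply: intg_eq => s _; rewrite mulrC.
apply: (ae_Rintegral (intgS tT' wDi) (intg_measurable (intgS tT' ki)) _).2.
apply: ae_imp2 imS FS _ => s H1 H2; rewrite in_itv/= => /andP[s0 st].
have sT : s \in `[0, T] by rewrite in_itv/= s0 (le_trans st)//; case/andP: tT'.
have {}H1 := H1 sT; have {}H2 : F s = S *m q s by exact: H2.
have SGSv v : S *m (G *m (S *m v)) = S *m v by rewrite !mulmxA SGS.
have Ds : D s = dot (q s) (S *m q s).
  by rewrite /D H2 dot_mulmx St SGSv.
have D's : D' s = 2 * dot (q s) (f s).
  have -> : D' s = dot (f s) (G *m F s) + dot (F s) (G *m f s).
    rewrite !dot_mulmxE -big_split/=; apply: eq_bigr => i _.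
    rewrite -big_split/=; apply: eq_bigr => j _.
    by rewrite mulrDr [f s j ord0 * _]mulrC.
  have -> : dot (F s) (G *m f s) = dot (f s) (G *m F s).
    by rewrite [RHS]dotC dot_mulmx Gt.
  have -> : dot (f s) (G *m F s) = dot (q s) (f s).
    by rewrite -{1}H1 H2 dot_mulmx St SGSv dotC dot_mulmx St H1.
  by rewrite mulrDl mul1r.
by rewrite Ds D's /w; ring.
Qed.

End VectorValued.

(** * Coupled systems *)

Section BlockMatrices.
Context {K : realType} {p : nat} {p_ : 'I_p -> nat}.

Lemma psdmx_mxdiag (A : forall i, 'M[K]_(p_ i)) :
  (forall i, psdmx (A i)) -> psdmx (\mxdiag_i A i).
Proof.
move=> pA; split.
  by rewrite tr_mxdiag; apply: eq_mxdiag => i; have [] := pA i.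
move=> v; rewrite -mulmxA -[v]submxcolK mul_mxdiag_mxcol tr_mxcol mul_mxrow_mxcol.
rewrite summxE sumr_ge0// => i _; rewrite mulmxA.
by have [_] := pA i; apply.
Qed.

Lemma mul_mxdiag (A B : forall i, 'M[K]_(p_ i)) :
  \mxdiag_i A i *m \mxdiag_i B i = \mxdiag_i (A i *m B i).
Proof.
rewrite {1}/mxdiag mul_mxblock_mxdiag; apply: eq_mxblock => i j.
case: eqVneq => [e|_]; last by rewrite mul0mx.
by case: j / e; rewrite !conform_mx_id.
Qed.

Lemma unitmx_mxdiag (A : forall i, 'M[K]_(p_ i)) :
  (forall i, A i \in unitmx) -> \mxdiag_i A i \in unitmx.
Proof.
move=> uA; have : \mxdiag_i A i *m \mxdiag_i (invmx (A i)) = 1%:M.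
  rewrite mul_mxdiag -mxdiagZ; apply: eq_mxdiag => i.
  by rewrite mulmxV.
by move=> /mulmx1_unit[].
Qed.

End BlockMatrices.

Section CoupledMatrices.
Context {K : realType} (d : phdae_data K) (bs : block_structure d).

Definition matS : 'M[K]_(phdim d) := matE d *m invmx (matQ d).

Lemma matQ_unit : matQ d \in unitmx.
Proof. by apply: unitmx_mxdiag => i; have [] := bs i. Qed.

Lemma matR_psd : psdmx (matR d).
Proof. by apply: psdmx_mxdiag => i; have [] := bs i. Qed.

Lemma matJd_skew : (matJd d)^T = - matJd d.
Proof.
rewrite /matJd tr_mxdiag -mxdiagN; apply: eq_mxdiag => i.
by have [] := bs i.
Qed.

Lemma matJo_skew : (matJo d)^T = - matJo d.
Proof.
rewrite /matJo /matJ /matJd addrC addKr tr_mxblock -mxblockN.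
apply: eq_mxblock => i j; case: (ltngtP i j) => _.
- by rewrite linearN /= trmxK.
- by rewrite opprK.
- by rewrite trmx0 oppr0.
Qed.

Lemma matS_mulQ : matS *m matQ d = matE d.
Proof. by rewrite /matS mulmxKV// matQ_unit. Qed.

Lemma matEQ_psd : psdmx ((matE d)^T *m matQ d).
Proof.
rewrite /matE /matQ tr_mxdiag mul_mxdiag; apply: psdmx_mxdiag => i.
by have [] := bs i.
Qed.

(** Congruence of E^T Q by Q^-1: as E^T Q = Q^T E, the matrix Q^-T (E^T Q) Q^-1 is E Q^-1. *)
Lemma matS_psd : psdmx matS.
Proof.
have uQ := matQ_unit.
have SE : matS = (invmx (matQ d))^T *m ((matE d)^T *m matQ d) *m invmx (matQ d).
  have [<- _] := matEQ_psd.
  by rewrite trmx_mul trmxK mulmxA -trmx_mul mulmxV// trmx1 mul1mx.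
by rewrite SE; apply: psdmx_congr; exact: matEQ_psd.
Qed.

End CoupledMatrices.

(** * The Peaceman-Rachford iteration *)

Section PeacemanRachford.
Context {K : realType}.
Local Notation mu := (@lebesgue_measure K).

Lemma cvg0_of_bounded_sums (a : nat -> K) C : (forall k, 0 <= a k) ->
  (forall n, \sum_(k < n) a k <= C) -> a k @[k --> \oo] --> 0.
Proof.
move=> a0 aC; apply: cvg_series_cvg_0; apply: nondecreasing_is_cvgn.
  apply/nondecreasing_seqP => n.
  by rewrite seriesEord /= big_ord_recr lerDl.
by exists C => _ [n _ <-]; rewrite seriesEord; exact: aC.
Qed.

Lemma telescope_le (N a : nat -> K) : (forall m, N m.+1 + a m <= N m) ->
  forall m, N m + \sum_(k < m) a k <= N 0%N.
Proof.
move=> Na; elim=> [|m IH]; first by rewrite big_ord0 addr0.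
apply: le_trans IH; rewrite big_ord_recr/= addrCA [leRHS]addrC lerD2l.
exact: Na.
Qed.

Lemma cvg0_squeeze (a b : nat -> K) c : (forall k, 0 <= a k <= c * b k) ->
  b k @[k --> \oo] --> 0 -> a k @[k --> \oo] --> 0.
Proof.
move=> ab b0; apply: (@squeeze_cvgr _ _ _ _ (fun=> 0) (fun k => c * b k)).
- exact: nearW.
- exact: cvg_cst.
- by rewrite -[X in _ --> X](mulr0 c); apply: cvgM => //; exact: cvg_cst.
Qed.

(* The paper's mu is nu, as mu denotes the Lebesgue measure.  In the application
   q k = Q (x^k - x), F k is the continuous representative of E (x^k - x), f k
   its weak derivative, S = E Q^-1, and A, B, D, z are as in the splitting. *)
Context {n : nat} (T lambda alpha nu omega : K)
  (S G R Jd Jo : 'M[K]_n) (q f F v : nat -> K -> 'cV[K]_n).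
Context (T0 : 0 < T) (l0 : 0 < lambda) (al : 0 <= alpha <= 1)
  (nuo : 0 <= nu <= omega).
Context (Sp : psdmx S) (Gp : psdmx G) (SGS : S *m G *m S = S) (Rp : psdmx R)
  (Jds : Jd^T = - Jd) (Jos : Jo^T = - Jo).

Let A := (1 - alpha) *: R + nu *: S - Jo.
Let B := Jd - alpha *: R + nu *: S.
Let D k t := f k t - B *m q k t.
Let z k t := q k t + lambda *: D k t.
Let w t := expR (- 2 * omega * t).

Context (qL : forall k, L2 T (q k)) (fL : forall k, L2 T (f k))
  (vL : forall k, L2 T (v k))
  (Ff : forall k i, primitive T (fun t => F k t i ord0) (fun t => f k t i ord0))
  (F0 : forall k, F k 0 = 0) (FS : forall k, aeq T (F k) (fun t => S *m q k t))
  (zv : forall k, aeq T (fun t => v k t + lambda *: (A *m v k t))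
                        (fun t => q k t - lambda *: D k t))
  (zv' : forall k, aeq T (z k.+1) (fun t => v k t - lambda *: (A *m v k t))).

Let wnorm t (h : K -> 'cV[K]_n) := \int[mu]_(s in `[0, t]) (w s * enorm (h s) ^+ 2).
Let dissip k t := \int[mu]_(s in `[0, t]) (w s * dot (q k s) (D k s)).

Lemma pr_w_gt0 t : 0 < w t.
Proof. exact: expR_gt0. Qed.

Lemma pr_w_ge t : t \in `[0, T] -> w T <= w t.
Proof.
rewrite in_itv/= => /andP[t0 tT]; rewrite ler_expR !mulNr lerN2.
by rewrite ler_wpM2l// mulr_ge0//; case/andP: nuo; apply: le_trans.
Qed.

Lemma pr_w_continuous : {within `[0, T], continuous w}.
Proof. exact: primitive_continuous (ltW T0) (primitive_expR T (- 2 * omega)). Qed.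

Lemma intg_wdot (g h : K -> 'cV[K]_n) : L2 T g -> L2 T h ->
  intg 0 T (fun s => w s * dot (g s) (h s)).
Proof.
move=> gL hL.
have := intgM_continuous (ltW T0) (intg_dot gL hL) pr_w_continuous.
by apply: intg_eq => s _; rewrite mulrC.
Qed.

Lemma pr_DL k : L2 T (D k).
Proof. by apply: L2B => //; exact: L2_mulmx. Qed.

Lemma pr_zL k : L2 T (z k).
Proof. by apply: L2D => //; apply: L2Z; exact: pr_DL. Qed.

Lemma pr_A_ge0 u : 0 <= dot u (A *m u).
Proof.
have /andP[a0 a1] := al; have /andP[nu0 _] := nuo.
rewrite /A mulmxBl mulmxDl -!scalemxAl !dotDr dotNr !dotZr (skew_dot _ Jos) subr0.
have [_ S0] := (psdmxP _).1 Sp; have [_ R0] := (psdmxP _).1 Rp.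
by rewrite addr_ge0 ?mulr_ge0 ?subr_ge0.
Qed.

(** The energy identity turns <q, f> into the boundary term plus omega q^T S q; subtracting <q, B q>
    contributes - nu q^T S q + alpha q^T R q, and Jd drops out. *)
Lemma pr_dissip_eq k t : t \in `[0, T] -> dissip k t =
  2^-1 * (w t * dot (F k t) (G *m F k t)) +
  \int[mu]_(s in `[0, t]) ((omega - nu) * (w s * dot (q k s) (S *m q k s)) +
     alpha * (w s * dot (q k s) (R *m q k s))).
Proof.
move=> tT; move: (tT); rewrite in_itv/= => tT'.
have SqL := L2_mulmx S (qL k); have RqL := L2_mulmx R (qL k).
rewrite (energy_identity omega T0 Sp Gp SGS (Ff k) (fL k) (qL k) (F0 k) (FS k) tT).
have i1 : intg 0 T (fun s => w s *
    (2 * dot (q k s) (f k s) - 2 * omega * dot (q k s) (S *m q k s))).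
  apply: intg_eq (intgB (intgZ 2 (intg_wdot (qL k) (fL k)))
    (intgZ (2 * omega) (intg_wdot (qL k) SqL))) => s _.
  by ring.
have i2 := intgD (intgZ (omega - nu) (intg_wdot (qL k) SqL))
  (intgZ alpha (intg_wdot (qL k) RqL)).
rewrite -RintegralZl//; last exact: intgS i1.
rewrite -RintegralD//; [|exact/(intgS tT')/intgZ|exact: intgS i2].
apply: eq_Rintegral => s _; rewrite -/(w s) /D /B.
rewrite mulmxDl mulmxBl -!scalemxAl dotDr dotNr !dotDr dotNr !dotZr.
by rewrite (skew_dot _ Jds); field.
Qed.

Lemma pr_dissip_ge k t : t \in `[0, T] ->
  2^-1 * (w t * dot (F k t) (G *m F k t)) <= dissip k t /\
  alpha * (\int[mu]_(s in `[0, t]) (w s * dot (q k s) (R *m q k s))) <= dissip k t.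
Proof.
move=> tT; move: (tT); rewrite in_itv/= => tT'.
have SqL := L2_mulmx S (qL k); have RqL := L2_mulmx R (qL k).
have [_ S0] := (psdmxP _).1 Sp; have [_ R0] := (psdmxP _).1 Rp.
have [_ G0] := (psdmxP _).1 Gp.
have /andP[a0 a1] := al; have /andP[nu0 nuw] := nuo.
have i1 := intgS tT' (intgZ (omega - nu) (intg_wdot (qL k) SqL)).
have i2 := intgS tT' (intgZ alpha (intg_wdot (qL k) RqL)).
rewrite pr_dissip_eq// RintegralD// RintegralZl//; last first.
  exact/(intgS tT')/intg_wdot.
rewrite [X in _ /\ _ <= _ + (_ + X)]RintegralZl//; last first.
  exact/(intgS tT')/intg_wdot.
rewrite [X in _ <= _ + (_ + X) /\ _]RintegralZl//; last first.
  exact/(intgS tT')/intg_wdot.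
have I1 : 0 <= \int[mu]_(s in `[0, t]) (w s * dot (q k s) (S *m q k s)).
  by apply: Rintegral_ge0 => s _; rewrite mulr_ge0// ltW// pr_w_gt0.
have I2 : 0 <= \int[mu]_(s in `[0, t]) (w s * dot (q k s) (R *m q k s)).
  by apply: Rintegral_ge0 => s _; rewrite mulr_ge0// ltW// pr_w_gt0.
have onu : 0 <= omega - nu by rewrite subr_ge0.
split; first by rewrite lerDl addr_ge0// mulr_ge0.
rewrite addrA lerDr addr_ge0 ?mulr_ge0//.
exact/ltW/pr_w_gt0.
Qed.

Lemma pr_dissip_ge0 k t : t \in `[0, T] -> 0 <= dissip k t.
Proof.
move=> tT; have [H _] := pr_dissip_ge k tT; apply: le_trans H.
have [_ G0] := (psdmxP _).1 Gp.
by rewrite !mulr_ge0//; exact/ltW/pr_w_gt0.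
Qed.

(* One step: |v - lambda A v|^2 = |v + lambda A v|^2 - 4 lambda <v, A v>, and
   likewise for q and D, with <v, A v> >= 0. *)
Lemma pr_step k t : t \in `[0, T] ->
  wnorm t (z k.+1) + 4 * lambda * dissip k t <= wnorm t (z k).
Proof.
move=> tT; move: (tT); rewrite in_itv/= => tT'.
pose h s := w s * dot (z k s) (z k s) - 4 * lambda * (w s * dot (q k s) (D k s)).
pose h' s := h s - 4 * lambda * (w s * dot (v k s) (A *m v k s)).
have hi : intg 0 T h.
  apply: intgB; first by apply: intg_wdot; exact: pr_zL.
  by apply: intgZ; apply: intg_wdot => //; exact: pr_DL.
have vi := intgZ (4 * lambda) (intg_wdot (vL k) (L2_mulmx A (vL k))).
have h'i : intg 0 T h' by exact: intgB.
have zi := intg_wdot (pr_zL k.+1) (pr_zL k.+1).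
have E : wnorm t (z k.+1) = \int[mu]_(s in `[0, t]) h' s.
  have -> : wnorm t (z k.+1) =
      \int[mu]_(s in `[0, t]) (w s * dot (z k.+1 s) (z k.+1 s)).
    by apply: eq_Rintegral => s _; rewrite enorm_sqr.
  apply: (ae_Rintegral (intgS tT' zi) (intg_measurable (intgS tT' h'i)) _).2.
  apply: ae_imp2 (zv k) (zv' k) _ => s H1 H2; rewrite in_itv/= => /andP[s0 st].
  have sT : s \in `[0, T] by rewrite in_itv/= s0 (le_trans st)//; case/andP: tT'.
  have {}H1 := H1 sT; have {}H2 : z k.+1 s = v k s - lambda *: (A *m v k s) := H2 sT.
  have := congr1 (fun u => dot u u) H1; rewrite /= dot_addZ dot_subZ => {}H1.
  rewrite /h' /h H2 /z dot_addZ dot_subZ.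
  move: H1; set c1 := dot _ _; set c2 := dot _ _; set c3 := dot _ _.
  set c4 := dot _ _; set c5 := dot _ _; set c6 := dot _ _ => H1.
  have -> : c1 - 2 * lambda * c2 + lambda ^+ 2 * c3 =
    c4 - 2 * lambda * c5 + lambda ^+ 2 * c6 - 4 * lambda * c2 by rewrite -H1; ring.
  by rewrite /w; ring.
have -> : wnorm t (z k) = \int[mu]_(s in `[0, t]) h s + 4 * lambda * dissip k t.
  rewrite -RintegralZl//; last exact/(intgS tT')/intg_wdot/pr_DL.
  rewrite -RintegralD//; last 2 first.
  - exact: intgS hi.
  - exact/(intgS tT')/intgZ/intg_wdot/pr_DL.
  by apply: eq_Rintegral => s _; rewrite /h enorm_sqr subrK.
rewrite lerD2r E; apply: le_Rintegral => //.
- exact: intgS h'i.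
- exact: intgS hi.
move=> s _; rewrite /h' gerBl !mulr_ge0 ?pr_A_ge0 ?ltW ?pr_w_gt0//.
Qed.

(** Telescoping [pr_step] on [0, t] bounds the sum by the initial norm on [0, t]; enlarging this to
    [0, T] makes the bound independent of t, so that it can be integrated in t. *)
Lemma pr_sum_le m t : t \in `[0, T] ->
  \sum_(k < m) dissip k t <= wnorm T (z 0%N) / (4 * lambda).
Proof.
move=> tT; have l4 : 0 < 4 * lambda by rewrite mulr_gt0.
rewrite ler_pdivlMr// mulrC mulr_sumr.
have H : wnorm t (z m) + \sum_(k < m) 4 * lambda * dissip k t <= wnorm t (z 0%N).
  exact: (telescope_le (fun j => pr_step j tT) m).
have N0 s : 0 <= wnorm s (z m).
  by apply: Rintegral_ge0 => x _; rewrite mulr_ge0 ?sqr_ge0// ltW// pr_w_gt0.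
apply: le_trans (_ : wnorm t (z 0%N) <= _).
  by apply: le_trans H; rewrite lerDr.
have zi : intg 0 T (fun s => w s * enorm (z 0%N s) ^+ 2).
  apply: intg_eq (intg_wdot (pr_zL 0) (pr_zL 0)) => s _.
  by rewrite enorm_sqr.
move: tT; rewrite in_itv/= => /andP[t0 tT].
rewrite -subr_ge0 (Rintegral_cc_split zi t0 tT (lexx T)).
by apply: Rintegral_ge0 => x _; rewrite mulr_ge0 ?sqr_ge0// ltW// pr_w_gt0.
Qed.

Lemma pr_dissip_cvg0 t : t \in `[0, T] -> dissip k t @[k --> \oo] --> 0.
Proof.
move=> tT; apply: cvg0_of_bounded_sums (fun m => pr_sum_le m tT) => k.
exact: pr_dissip_ge0.
Qed.

(** F = S G F holds at every t by continuity, so [psdmx_dot_le] at the vector G F gives |F|^2 <= tr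
    S F^T G F. The factor 2 undoes the one half in the dissipation, and w T is the least value of
    the weight. *)
Lemma pr_F_le k t : t \in `[0, T] ->
  dot (F k t) (F k t) <= \tr S * 2 / w T * dissip k t.
Proof.
move=> tT; have [St S0] := (psdmxP _).1 Sp; have [_ G0] := (psdmxP _).1 Gp.
have SGF : S *m (G *m F k t) = F k t.
  apply/eqP; rewrite eq_sym -subr_eq0; apply/eqP.
  have := primitive_mulmx_eq0 (M := 1%:M - S *m G) T0 (Ff k) _ tT.
  rewrite mulmxBl mul1mx mulmxA; apply.
  apply: ae_imp (FS k) _ => s H sT; rewrite H//.
  by rewrite mulmxA mulmxBl mul1mx SGS subrr mul0mx.
have := psdmx_dot_le (G *m F k t) Sp; rewrite !SGF => H.
apply: le_trans H _; rewrite dotC -!mulrA ler_wpM2l ?psdmx_tr_ge0//.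
have [H _] := pr_dissip_ge k tT.
rewrite mulrA -ler_pdivrMl ?divr_gt0 ?pr_w_gt0// invf_div.
apply: le_trans H; rewrite mulrAC mulrC ler_wpM2l ?invr_ge0//.
by rewrite ler_wpM2r// pr_w_ge.
Qed.

Lemma pr_F_pointwise_cvg t : t \in `[0, T] ->
  dot (F k t) (F k t) @[k --> \oo] --> 0.
Proof.
move=> tT; apply: (@cvg0_squeeze _ _ (\tr S * 2 / w T) _ (pr_dissip_cvg0 tT)) => k.
by rewrite dot_ge0 pr_F_le.
Qed.

(** The sum over k of |F k t|^2 is at most C for every t. Integrating finite sums gives T C as a
    bound on the sums of the integrals, whose terms must then tend to 0. *)
Lemma pr_F_L2_cvg :
  (\int[mu]_(t in `[0, T]) dot (F k t) (F k t)) @[k --> \oo] --> 0.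
Proof.
pose C := \tr S * 2 / w T * (wnorm T (z 0%N) / (4 * lambda)).
have Fi k : intg 0 T (fun t => dot (F k t) (F k t)).
  have -> : (fun t => dot (F k t) (F k t)) =
      (fun t => \sum_i F k t i ord0 * F k t i ord0).
    by apply/funext => t; rewrite dotE.
  apply: intg_sum => i; have cF := primitive_continuous (ltW T0) (Ff k i).
  exact/intg_continuous/within_continuousM.
apply: (@cvg0_of_bounded_sums _ (T * C)) => [k|m].
  by apply: Rintegral_ge0 => t _; exact: dot_ge0.
have Si j : intg 0 T (fun t => \sum_(k < j) dot (F k t) (F k t)).
  exact: (@intg_sum _ 0 T _ _ (fun (k : 'I_j) t => dot (F k t) (F k t))).
have -> : \sum_(k < m) \int[mu]_(t in `[0, T]) dot (F k t) (F k t) =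
    \int[mu]_(t in `[0, T]) (\sum_(k < m) dot (F k t) (F k t)).
  elim: m => [|m IH].
    rewrite big_ord0; under eq_Rintegral do rewrite big_ord0.
    by rewrite Rintegral_cst// mul0r.
  rewrite big_ord_recr/= IH -RintegralD//; [|exact: Si|exact: Fi].
  by apply: eq_Rintegral => t _; rewrite big_ord_recr.
apply: le_trans (_ : \int[mu]_(t in `[0, T]) C <= _).
  apply: le_Rintegral => //.
  - exact: Si.
  - by apply: intg_continuous; apply: continuous_subspaceT => t; exact: cvg_cst.
  move=> t tT; apply: le_trans (_ : \sum_(k < m) \tr S * 2 / w T * dissip k t <= _).
    by apply: ler_sum => k _; exact: pr_F_le.
  rewrite -mulr_sumr ler_wpM2l ?pr_sum_le//.
  by rewrite !mulr_ge0 ?psdmx_tr_ge0// invr_ge0 ltW// pr_w_gt0.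
have muT : fine (mu `[0, T]) = T.
  by rewrite lebesgue_measure_itv/= lte_fin T0 -EFinB/= subr0.
rewrite Rintegral_cst// mulrC le_eqVlt; apply/orP; left; apply/eqP.
by congr (_ * _); exact: muT.
Qed.

Lemma pr_R_L2_cvg : 0 < alpha ->
  (\int[mu]_(t in `[0, T]) dot (R *m q k t) (R *m q k t)) @[k --> \oo] --> 0.
Proof.
move=> a0; have TT : T \in `[0, T] by rewrite in_itv/= lexx ltW.
apply: (cvg0_squeeze _ (pr_dissip_cvg0 TT)) => k.
apply/andP; split; first by apply: Rintegral_ge0 => t _; exact: dot_ge0.
have RqL := L2_mulmx R (qL k).
have [_ H] := pr_dissip_ge k TT.
(* tr R comes from |R q|^2 <= tr R q^T R q, 1 / w T from inserting the weight, and 1 / alpha from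
   the share of R in the dissipation. *)
instantiate (1 := \tr R / w T / alpha).
rewrite -mulrA; apply: le_trans (_ : \tr R / w T *
  \int[mu]_(s in `[0, T]) (w s * dot (q k s) (R *m q k s)) <= _); last first.
  rewrite ler_wpM2l ?divr_ge0 ?psdmx_tr_ge0 ?(ltW (pr_w_gt0 T))//.
  by rewrite ler_pdivlMl.
rewrite -RintegralZl//; last exact: intg_wdot.
apply: le_Rintegral => //.
- exact: intg_dot.
- exact/intgZ/intg_wdot.
move=> s sT; apply: le_trans (psdmx_dot_le _ Rp) _.
rewrite -mulrA ler_wpM2l ?psdmx_tr_ge0// mulrA ler_peMl//.
  by have [_] := (psdmxP _).1 Rp; apply.
by rewrite mulrC ler_pdivlMr ?pr_w_gt0// mul1r pr_w_ge.
Qed.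

Lemma pr_wnorm_noninc k : wnorm T (z k.+1) <= wnorm T (z k).
Proof.
have TT : T \in `[0, T] by rewrite in_itv/= lexx ltW.
apply: le_trans (pr_step k TT); rewrite lerDl.
by rewrite !mulr_ge0// ?pr_dissip_ge0// ltW.
Qed.

(** Nonexpansiveness of the resolvent: the expansion of |q + lambda D|^2 adds to |q|^2 the terms 2
    lambda <q, D> and lambda^2 |D|^2, both with nonnegative weighted integrals. *)
Lemma pr_q_le k : wnorm T (q k) <= wnorm T (z k).
Proof.
have TT : T \in `[0, T] by rewrite in_itv/= lexx ltW.
have DL := pr_DL k.
have qq := intg_wdot (qL k) (qL k); have qD := intg_wdot (qL k) DL.
have DD := intg_wdot DL DL.
have -> : wnorm T (z k) = wnorm T (q k) + (2 * lambda * dissip k T +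
    lambda ^+ 2 * \int[mu]_(s in `[0, T]) (w s * dot (D k s) (D k s))).
  have -> : wnorm T (q k) = \int[mu]_(s in `[0, T]) (w s * dot (q k s) (q k s)).
    by apply: eq_Rintegral => s _; rewrite enorm_sqr.
  rewrite -!RintegralZl// -RintegralD//; try exact: intgZ.
  rewrite -RintegralD//; last by apply: intgD; exact: intgZ.
  apply: eq_Rintegral => s _; rewrite enorm_sqr /z.
  by rewrite dot_addZ /w; ring.
rewrite lerDl; apply: addr_ge0; apply: mulr_ge0.
- by rewrite mulr_ge0// ltW.
- exact: pr_dissip_ge0.
- exact: sqr_ge0.
by apply: Rintegral_ge0 => s _; rewrite mulr_ge0 ?dot_ge0// ltW// pr_w_gt0.
Qed.

Lemma peaceman_rachford_cvg :
  [/\ (\int[mu]_(t in `[0, T]) dot (F k t) (F k t)) @[k --> \oo] --> 0,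
      forall t, t \in `[0, T] -> dot (F k t) (F k t) @[k --> \oo] --> 0,
      0 < alpha -> (\int[mu]_(t in `[0, T]) dot (R *m q k t) (R *m q k t))
        @[k --> \oo] --> 0,
      forall k, wnorm T (z k.+1) <= wnorm T (z k) &
      forall k, wnorm T (q k) <= wnorm T (z k)].
Proof.
split; [exact: pr_F_L2_cvg|exact: pr_F_pointwise_cvg|exact: pr_R_L2_cvg|
  exact: pr_wnorm_noninc|exact: pr_q_le].
Qed.

End PeacemanRachford.

(** * The iteration in terms of differences from the solution *)

Section Iteration.
Context {K : realType}.
Local Notation mu := (@lebesgue_measure K).

Lemma primitiveB T (F f G g : K -> K) : primitive T F f -> primitive T G g ->
  primitive T (fun t => F t - G t) (fun t => f t - g t).
Proof.
move=> pF pG; have := primitiveD pF (primitiveZ (-1) pG).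
by under eq_fun do rewrite mulN1r; under [X in primitive _ _ X]eq_fun do rewrite mulN1r.
Qed.

Lemma mulmxfK (n : nat) (Q : 'M[K]_n) (u : K -> 'cV[K]_n) : Q \in unitmx ->
  mulmxf (invmx Q) (mulmxf Q u) = u.
Proof. by move=> uQ; apply/funext => t; rewrite /mulmxf mulKmx. Qed.

Lemma cvg_sqrt0 (a : nat -> K) : a k @[k --> \oo] --> 0 ->
  Num.sqrt (a k) @[k --> \oo] --> 0.
Proof.
move=> a0; rewrite -[X in _ --> X](@sqrtr0 K).
by apply: continuous_cvg a0; exact: sqrt_continuous.
Qed.

Context (d : phdae_data K) (alpha nu : K).
Local Notation n := (phdim d).
Local Notation Q := (matQ d).
Local Notation E := (matE d).

Definition opA : 'M[K]_n := (1 - alpha) *: matR d + nu *: matS d - matJo d.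
Definition opB : 'M[K]_n := matJd d - alpha *: matR d + nu *: matS d.

Lemma opMQ_mulQ u : Q \in unitmx -> opMQ d alpha nu (mulmxf Q u) = opM d alpha nu u.
Proof. by move=> uQ; rewrite /opMQ mulmxfK. Qed.

Lemma opNQE y t : Q \in unitmx -> opNQ d alpha nu y t = opA *m y t.
Proof.
by move=> uQ; rewrite /opNQ /opN /mulmxf -mulmxA mulKVmx.
Qed.

(** M is affine, so B u cancels. [wderiv] picks a representative, hence the two weak derivatives
    stay a difference and are not merged into one. *)
Lemma opM_sub u x t : opM d alpha nu u t - opM d alpha nu x t =
  wderiv (horizon d) (mulmxf E u) t - wderiv (horizon d) (mulmxf E x) t
  - opB *m (Q *m (u t - x t)).
Proof.
rewrite /opM -/opB !mulmxBr -!mulmxA.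
set a := wderiv _ _ _; set b := wderiv _ _ _; set c := opB *m _.
set e := opB *m (Q *m x t); set h := matB d *m _.
by apply/colP => i; rewrite !mxE; ring.
Qed.

(** This is M x + N x = 0: Jd and Jo add up to J, the two shares of R add up and the mu terms
    cancel. Hence x is a fixed point of the iteration. *)
Lemma opM_weak_solution x : weak_solution d x ->
  aeq (horizon d) (opM d alpha nu x) (fun t => - (opA *m (Q *m x t))).
Proof.
move=> [_ _ _ wx]; apply: ae_imp wx _ => t H tT; rewrite /opM H//.
have -> : matJ d = matJo d + matJd d by rewrite /matJo subrK.
rewrite -/(matS d) /opA -!mulmxA.
move: (matJo d) (matJd d) => Jo Jd.
rewrite !(mulmxDl, mulNmx) -!scalemxAl.
set a := Jo *m _; set b := Jd *m _; set c := matR d *m _.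
set e := matS d *m _; set h := matB d *m _.
by apply/colP => i; rewrite !mxE; ring.
Qed.

End Iteration.

Theorem theorem23 (K : realType) (d : phdae_data K) (lambda alpha mu omega : K)
    (xk : nat -> K -> 'cV[K]_(phdim d)) (x : K -> 'cV[K]_(phdim d))
    (hd : coupled_phdae d)
    (hlambda : 0 < lambda) (halpha : 0 <= alpha <= 1) (hmu : 0 <= mu <= omega)
    (hxk0 : domM d omega (xk 0%N))
    (hxkS : forall k, iteration_step d alpha mu omega lambda (xk k) (xk k.+1))
    (hx : weak_solution d x) :
  [/\ (* (a) *)
      (fun k => L2norm (horizon d) (mulmxf (matE d) (xk k) \- mulmxf (matE d) x))
        @ \oo --> (0 : K),
      (* (b) *)
      forall t : K, 0 < t <= horizon d ->
        (fun k => crep (horizon d) (mulmxf (matE d) (xk k)) t) @ \oo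
          --> crep (horizon d) (mulmxf (matE d) x) t,
      (* (c) *)
      0 < alpha ->
        (fun k => L2norm (horizon d)
           (mulmxf (matR d *m matQ d) (xk k) \- mulmxf (matR d *m matQ d) x))
          @ \oo --> (0 : K) &
      (* (d) *)
      let zop v := id_plus lambda (opMQ d alpha mu) (mulmxf (matQ d) v) in
      nonincreasing_seq
        (fun k => L2wnorm (horizon d) omega (zop (xk k) \- zop x)) /\
      forall k, L2wnorm (horizon d) omega (xk k \- x) <=
        opnorm (invmx (matQ d))
          * L2wnorm (horizon d) omega (zop (xk k) \- zop x)].
Proof.
have [T0 bs _ _ _] := hd.
have T0' := ltW T0.
have uQ : matQ d \in unitmx by exact: matQ_unit.
have [xL xH x0 _] := hx.
have xkD k : domM d omega (xk k).
  elim: k => // k _; have [y [w [_ [[u uD <-] _] ->]]] := hxkS k.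
  by rewrite mulmxfK.
have xkL k : L2 (horizon d) (xk k).
  by have [H _ _] := xkD k; exact: (L2wE omega (xk k) T0').1 H.
have /choice[y hy] : forall k, exists y, [/\ L2 (horizon d) y,
    aeq (horizon d) (id_plus lambda (opNQ d alpha mu) y)
      (id_plus (- lambda) (opMQ d alpha mu) (mulmxf (matQ d) (xk k))) &
    aeq (horizon d) (id_plus lambda (opMQ d alpha mu) (mulmxf (matQ d) (xk k.+1)))
      (id_plus (- lambda) (opNQ d alpha mu) y)].
  move=> k; have [y [w [[yL y1] [[u _ uw] w1] ->]]] := hxkS k.
  exists y; split; [exact: (L2wE omega y T0').1 yL|exact: y1|].
  by rewrite -uw (mulmxfK _ uQ) uw.
pose q k t := matQ d *m (xk k t - x t).
pose f k t := wderiv (horizon d) (mulmxf (matE d) (xk k)) t -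
  wderiv (horizon d) (mulmxf (matE d) x) t.
pose F k t := crep (horizon d) (mulmxf (matE d) (xk k)) t -
  crep (horizon d) (mulmxf (matE d) x) t.
(* For the solution the intermediate function of a step is Q x itself, so Q x is what [y k] is
   compared with. *)
pose v k t := y k t - matQ d *m x t.
have [xwL xc xp] := H1_crep T0 xH.
have xkH k := let: And3 _ H _ := xkD k in H1_crep T0 H.
have qL k : L2 (horizon d) (q k).
  by apply: L2_mulmx; apply: L2B; [exact: xkL|exact: xL].
have fL k : L2 (horizon d) (f k).
  by have [H _ _] := xkH k; apply: L2B; [exact: H|exact: xwL].
have vL k : L2 (horizon d) (v k).
  by have [H _ _] := hy k; apply: L2B; [exact: H|exact: (L2_mulmx _ xL)].
have Ff k i : primitive (horizon d) (fun t => F k t i ord0) (fun t => f k t i ord0).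
  have [_ _ pk] := xkH k; have := primitiveB (pk i) (xp i).
  have e (g h : K -> 'cV[K]_(phdim d)) :
    (fun t => (g t - h t) i ord0) = (fun t => g t i ord0 - h t i ord0).
    by apply/funext => t; rewrite !mxE.
  by rewrite /F /f !e.
have F0 k : F k 0 = 0 by rewrite /F; have [_ _ ->] := xkD k; rewrite x0 subrr.
have FE k : aeq (horizon d) (F k) (fun t => matE d *m (xk k t - x t)).
  have [_ ck _] := xkH k; apply: ae_imp2 ck xc _ => t H1 H2 tT.
  by rewrite /F H1// H2// /mulmxf mulmxBr.
have FS k : aeq (horizon d) (F k) (fun t => matS d *m q k t).
  by apply: ae_imp (FE k) _ => t H tT; rewrite H// /q mulmxA matS_mulQ.
have wx := opM_weak_solution alpha mu hx.
have zE k t : id_plus lambda (opMQ d alpha mu) (mulmxf (matQ d) (xk k)) t -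
    id_plus lambda (opMQ d alpha mu) (mulmxf (matQ d) x) t =
    q k t + lambda *: (f k t - opB d alpha mu *m q k t).
  rewrite /id_plus !opMQ_mulQ// -opM_sub /q mulmxBr scalerBr /mulmxf.
  set a := matQ d *m _; set b := matQ d *m _; set c := _ *: _; set e := _ *: _.
  by apply/colP => i; rewrite !mxE; ring.
have zv k : aeq (horizon d) (fun t => v k t + lambda *: (opA d alpha mu *m v k t))
    (fun t => q k t - lambda *: (f k t - opB d alpha mu *m q k t)).
  have [_ H _] := hy k; apply: ae_imp2 H wx _ => t H1 H2 tT.
  have {}H1 := H1 tT; have {}H2 := H2 tT.
  move: H1; rewrite /id_plus opNQE// opMQ_mulQ// => H1.
  rewrite -opM_sub H2 /v /q !mulmxBr.
  move: H1; rewrite /mulmxf; set a := opA d alpha mu *m _.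
  set b := opA d alpha mu *m _; set c := matQ d *m _; set e := matQ d *m _.
  set m := opM _ _ _ _ _; set yt := y k t => H1.
  apply/colP => i; move: H1 => /colP/(_ i); rewrite !mxE => H1.
  by move: H1; rewrite mulNr; lra.
have zv' k : aeq (horizon d)
    (fun t => q k.+1 t + lambda *: (f k.+1 t - opB d alpha mu *m q k.+1 t))
    (fun t => v k t - lambda *: (opA d alpha mu *m v k t)).
  have [_ _ H] := hy k; apply: ae_imp2 H wx _ => t H1 H2 tT.
  have {}H1 := H1 tT; have {}H2 := H2 tT.
  move: H1; rewrite /id_plus opNQE// opMQ_mulQ// => H1.
  rewrite -opM_sub H2 /v /q !mulmxBr.
  move: H1; rewrite /mulmxf; set a := opA d alpha mu *m _.
  set b := opA d alpha mu *m _; set c := matQ d *m _; set e := matQ d *m _.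
  set m := opM _ _ _ _ _; set yt := y k t => H1.
  apply/colP => i; move: H1 => /colP/(_ i); rewrite !mxE => H1.
  by move: H1; rewrite mulNr; lra.
have [G Gp SGS] := psdmx_ginv (matS_psd bs).
have [ca cb cc cd ce] := peaceman_rachford_cvg T0 hlambda halpha hmu
  (matS_psd bs) Gp SGS (matR_psd bs) (matJd_skew bs) (matJo_skew d)
  qL fL vL Ff F0 FS zv zv'.
split.
(* [ca] concerns continuous representatives, the norm in (a) the functions E x^k and E x themselves;
   they agree almost everywhere, so the integrals are equal. *)
- apply: cvg_sqrt0; move: ca; apply: cvg_trans; apply: near_eq_cvg.
  apply: nearW => k; apply/esym.
  have dL : L2 (horizon d) (fun t => matE d *m (xk k t - x t)).
    by apply: L2_mulmx; apply: L2B; [exact: xkL|exact: xL].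
  transitivity (\int[lebesgue_measure]_(t in `[0, horizon d])
    dot (matE d *m (xk k t - x t)) (matE d *m (xk k t - x t))).
    by apply: eq_Rintegral => t _; rewrite enorm_sqr /= /mulmxf mulmxBr.
  have Fi : measurable_fun `[0, horizon d] (fun t => dot (F k t) (F k t)).
    have -> : (fun t => dot (F k t) (F k t)) =
        (fun t => \sum_i F k t i ord0 * F k t i ord0).
      by apply/funext => t; rewrite dotE.
    apply: measurable_sum => i.
    have cF := primitive_continuous T0' (Ff k i).
    by apply: measurable_funM; exact: within_continuous_measurable cF.
  apply: (ae_Rintegral (intg_dot dL dL) Fi _).2.
  by apply: ae_imp (FE k) _ => t H tT; rewrite H.
- move=> t /andP[t0 tT]; have tT' : t \in `[0, horizon d].
    by rewrite in_itv/= tT ltW.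
  have := cb t tT' => /cvgr0Pnorm_le ct.
  apply: cvg_col => i; apply/cvgrPdist_le => e e0.
  (* Threshold e^2, because the square of each coordinate of F is bounded by |F|^2. *)
  have e2 : 0 < e ^+ 2 by rewrite exprn_gt0.
  apply: filterS (ct _ e2) => k Hk.
  rewrite distrC -(ler_sqr (x := `|_|)) ?nnegrE ?(ltW e0)// real_normK ?num_real//.
  apply: le_trans Hk; rewrite ger0_norm ?dot_ge0//.
  by apply: le_trans (sqr_coord_le (F k t) i); rewrite /F !mxE.
- move=> a0; apply: cvg_sqrt0; move: (cc a0); apply: cvg_trans.
  apply: near_eq_cvg; apply: nearW => k.
  apply: eq_Rintegral => t _; rewrite enorm_sqr /= /mulmxf /q.
  by rewrite -mulmxBr -mulmxA.
- have zE' k : (id_plus lambda (opMQ d alpha mu) (mulmxf (matQ d) (xk k)) \-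
      id_plus lambda (opMQ d alpha mu) (mulmxf (matQ d) x)) =
      (fun t => q k t + lambda *: (f k t - opB d alpha mu *m q k t)).
    by apply/funext => t; rewrite -zE.
  split.
    by apply/nonincreasing_seqP => k; rewrite !zE'; apply: ler_wsqrtr; exact: cd.
  move=> k; rewrite zE'.
  (* Since x^k - x = Q^-1 q, the operator norm bound holds pointwise under the weighted integral;
     [ce] then passes from q to z^k - z. *)
  apply: le_trans (_ : opnorm (invmx (matQ d)) *
    L2wnorm (horizon d) omega (q k) <= _); last first.
    by rewrite ler_wpM2l ?opnorm_ge0//; apply: ler_wsqrtr; exact: ce.
  rewrite -[X in X * _](ger0_norm (opnorm_ge0 _)) -sqrtr_sqr /L2wnorm.
  rewrite -sqrtrM ?sqr_ge0//; apply: ler_wsqrtr.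
  have dL : L2 (horizon d) (xk k \- x) by apply: L2B; [exact: xkL|exact: xL].
  have wi (h : K -> 'cV[K]_(phdim d)) : L2 (horizon d) h ->
      intg 0 (horizon d) (fun t => expR (-2 * omega * t) * enorm (h t) ^+ 2).
    move=> hL; apply: intg_eq (intg_wdot omega T0 hL hL) => t _.
    by rewrite enorm_sqr.
  rewrite -RintegralZl//; last exact: wi.
  apply: le_Rintegral => //; [exact: wi|exact/intgZ/wi|].
  move=> t _; rewrite [leRHS]mulrCA ler_wpM2l ?expR_ge0// -exprMn ler_sqr ?nnegrE.
  + by apply: le_trans (opnorm_le _ _); rewrite /q mulKmx.
  + exact: enorm_ge0.
  + by rewrite mulr_ge0 ?opnorm_ge0 ?enorm_ge0.
Qed.
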